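(* Let $\xi\in(\hat{\mathcal D}^{\pm}_0)^*$. The irreducible highest weight $\hat{\mathcal D}^{\pm}$-module $L(\hat{\mathcal D}^{\pm};\xi)$ is quasifinite if and only if $$\Delta^{\pm}_\xi(x)=\frac{F(x)}{2\sinh(x/2)},$$ where $F(x)$ is an even quasipolynomial such that $F(0)=0$. (The statement holds for each of the two choices of sign.)
   Context: Let $\mathcal D$ be the Lie algebra (under commutator) of operators spanned by $t^kf(D)$, $k\in\mathbb Z$, $f\in\mathbb C[w]$, $D=t\frac d{dt}$. Let $\hat{\mathcal D}=\mathcal D\oplus\mathbb CC$ ($C$ central) with $$[t^rf(D),t^sg(D)]=t^{r+s}\big(f(D+s)g(D)-f(D)g(D+r)\big)+\Psi\big(t^rf(D),t^sg(D)\big)C,$$ where $\Psi$ is the antisymmetric bilinear form with $\Psi(t^rf(D),t^sg(D))=\sum_{-r\le j\le -1}f(j)g(j+r)$ if $r=-s\ge0$ and $=0$ if $r+s\neq0$. It is $\mathbb Z$-graded by $\deg t^kf(D)=k$, $\deg C=0$. $\hat{\mathcal D}^-\subset\hat{\mathcal D}$ is the graded Lie subalgebra spanned by $C$ and all $t^kg(D+k/2)$, $k\in\mathbb Z$, with $g$ an odd polynomial if $k$ is even and $g$ an even polynomial if $k$ is odd. $\hat{\mathcal D}^+\subset\hat{\mathcal D}$ is the graded Lie subalgebra spanned by $C$ and all $t^kg(D+(k+1)/2)$, $k\in\mathbb Z$, $g$ an odd polynomial. $\hat{\mathcal D}^\pm_j$ denotes the degree $j$ component. For $\xi\in(\hat{\mathcal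 D}^\pm_0)^*$, $L(\hat{\mathcal D}^\pm;\xi)$ is the irreducible $\mathbb Z$-graded module $\bigoplus_{j\ge0}L_j$ (with $\hat{\mathcal D}^\pm_iL_j\subset L_{j-i}$) generated by a nonzero vector $v\in L_0$ with $hv=\xi(h)v$ for $h\in\hat{\mathcal D}^\pm_0$ and $\hat{\mathcal D}^\pm_jv=0$ for $j>0$. A graded module is quasifinite if all its graded components are finite-dimensional. Labels: for odd $n\ge1$, $\Delta^-_n=-\xi(D^n)$, $\Delta^+_n=-\xi((D+1/2)^n)$, and $\Delta^\pm_\xi(x)=\sum_{n\ge 1\text{ odd}}\Delta^\pm_n\,x^n/n!$ (formal power series). A quasipolynomial is a finite linear combination of functions $p(x)e^{\alpha x}$, $p$ a polynomial, $\alpha\in\mathbb C$. *)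

(* Defs.v *)
From HB Require Import structures.
From mathcomp Require Import all_boot all_order all_algebra.
From mathcomp Require Import finmap monalg.
From mathcomp Require Import complex.
From mathcomp Require Import reals.

Set Implicit Arguments.
Unset Strict Implicit.
Unset Printing Implicit Defensive.

Import GRing.Theory.
Local Open Scope ring_scope.

(* The finitely supported family x : int -> {poly K} stands for the operator
   \sum_k t^k x_k(D), where x_k is the coefficient x@_k. *)
Definition Dop (K : fieldType) : Type := {malg {poly K}[int]}.

Section DopLmodule.
Variable K : fieldType.

HB.instance Definition _ := GRing.Zmodule.on (Dop K).

Definition Dop_scale (c : K) (x : Dop K) : Dop K :=
  c%:P *: (x : {malg {poly K}[int]}).

Fact Dop_scaleA a b x : Dop_scale a (Dop_scale b x) = Dop_scale (a * b) x.
Proof. by rewrite /Dop_scale scalerA polyCM. Qed.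

Fact Dop_scale1 : left_id 1 Dop_scale.
Proof. by move=> x; rewrite /Dop_scale scale1r. Qed.

Fact Dop_scaleDr : right_distributive Dop_scale +%R.
Proof. by move=> a x y; rewrite /Dop_scale scalerDr. Qed.

Fact Dop_scaleDl x : {morph Dop_scale^~ x : a b / a + b}.
Proof. by move=> a b; rewrite /Dop_scale polyCD scalerDl. Qed.

HB.instance Definition _ := GRing.Zmodule_isLmodule.Build K (Dop K)
  Dop_scaleA Dop_scale1 Dop_scaleDr Dop_scaleDl.

End DopLmodule.

Section Dhat.
Variable K : fieldType.
Implicit Types (f g : {poly K}) (r s k : int).

Definition tD k f : Dop K := << f *g k >>.

(* f(D + c) *)
Definition pshift (c : K) f : {poly K} := f \Po ('X + c%:P).

Definition Dbr1 r f s g : Dop K :=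
  tD (r + s) (pshift s%:~R f * g - f * pshift r%:~R g).

(* \sum_{-n <= j <= -1} f(j) g(j+n), with j = i - n *)
Definition psi_pos (n : nat) f g : K :=
  \sum_(i < n) f.[i%:R - n%:R] * g.[i%:R].

Definition Psi1 r f s g : K :=
  if r + s == 0 then
    match r with
    | Posz n => psi_pos n f g
    | Negz n => - psi_pos n.+1 g f
    end
  else 0.

Definition Dbr (x y : Dop K) : Dop K :=
  \sum_(r <- msupp x) \sum_(s <- msupp y) Dbr1 r x@_r s y@_s.

Definition Psi (x y : Dop K) : K :=
  \sum_(r <- msupp x) \sum_(s <- msupp y) Psi1 r x@_r s y@_s.

(* The pair (x, c) stands for x + c C. *)
Definition Dhat : Type := (Dop K * K^o)%type.
HB.instance Definition _ := GRing.Lmodule.on Dhat.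

Definition bracket (x y : Dhat) : Dhat := (Dbr x.1 y.1, Psi x.1 y.1).

Definition tDhat k f : Dhat := (tD k f, 0).

Lemma bracket_tDhat r f s g :
  bracket (tDhat r f) (tDhat s g) = (Dbr1 r f s g, Psi1 r f s g).
Proof.
rewrite /bracket /Dbr /Psi /tDhat /tD /= !msuppU.
have psi0l n h : psi_pos n 0 h = 0.
  by rewrite /psi_pos big1 // => i _; rewrite horner0 mul0r.
have psi0r n h : psi_pos n h 0 = 0.
  by rewrite /psi_pos big1 // => i _; rewrite horner0 mulr0.
have [->|f0] := eqVneq f 0.
  rewrite !big_seq_fset0 /Dbr1 /Psi1 /pshift comp_poly0 !mul0r subrr /tD.
  by rewrite monalgU0; case: r => n; rewrite ?psi0l ?psi0r ?oppr0 if_same.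
have [->|g0] := eqVneq g 0.
  rewrite !big_seq_fset1 !big_seq_fset0 /Dbr1 /Psi1 /pshift comp_poly0 !mulr0.
  rewrite subrr /tD monalgU0.
  by case: r => n; rewrite ?psi0l ?psi0r ?oppr0 if_same.
by rewrite !big_seq_fset1 !mcoeffUU.
Qed.

Definition even_polyn f : Prop := f \Po (- 'X) = f.
Definition odd_polyn f : Prop := f \Po (- 'X) = - f.

Variant sign := Minus | Plus.

Definition Dpm_shift (e : sign) k : K :=
  match e with
  | Minus => k%:~R / 2%:R
  | Plus => (k + 1)%:~R / 2%:R
  end.

Definition Dpm_parity (e : sign) k g : Prop :=
  match e with
  | Minus => if (2 %| k)%Z then odd_polyn g else even_polyn g
  | Plus => odd_polyn g
  end.

(* The polynomials allowed at a given k form a subspace, so the span is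
   described degree by degree. *)
Definition Dpm (e : sign) (x : Dhat) : Prop :=
  forall k, exists2 g, Dpm_parity e k g & x.1@_k = pshift (Dpm_shift e k) g.

Definition homog k (x : Dhat) : Prop :=
  (forall r, r != k -> x.1@_r = 0) /\ (k != 0 -> x.2 = 0).

Definition Dpm_deg (e : sign) k (x : Dhat) : Prop := Dpm e x /\ homog k x.

(* phi restricts to a linear form on the subspace W; its values outside W
   play no role. *)
Definition linear_form_on (W : Dhat -> Prop) (phi : Dhat -> K) : Prop :=
  forall a x y, W x -> W y -> phi (a *: x + y) = a * phi x + phi y.

Definition subspace (V : lmodType K) (U : V -> Prop) : Prop :=
  U 0 /\ forall a u w, U u -> U w -> U (a *: u + w).

(* V is a module over the Lie algebra W; the values of act outside W play
   no role. *)
Definition lie_module (W : Dhat -> Prop) (V : lmodType K)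
    (act : Dhat -> V -> V) : Prop :=
  [/\ forall a x y v, W x -> W y -> act (a *: x + y) v = a *: act x v + act y v,
      forall x a v w, W x -> act x (a *: v + w) = a *: act x v + act x w &
      forall x y v, W x -> W y ->
        act (bracket x y) v = act x (act y v) - act y (act x v)].

Definition submodule (W : Dhat -> Prop) (V : lmodType K)
    (act : Dhat -> V -> V) (U : V -> Prop) : Prop :=
  subspace U /\ forall x u, W x -> U u -> U (act x u).

Definition irreducible (W : Dhat -> Prop) (V : lmodType K)
    (act : Dhat -> V -> V) : Prop :=
  (exists v : V, v != 0) /\
  forall U, submodule W act U -> (forall u, U u -> u = 0) \/ (forall u, U u).

Definition direct_sum (V : lmodType K) (L : int -> V -> Prop) : Prop :=
  [/\ forall j, subspace (L j),
      forall v, exists (s : seq int) (u : int -> V),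
        (forall j, L j (u j)) /\ v = \sum_(j <- s) u j &
      forall (s : seq int) (u : int -> V), uniq s -> (forall j, L j (u j)) ->
        \sum_(j <- s) u j = 0 -> forall j, j \in s -> u j = 0].

Definition graded_module (e : sign) (V : lmodType K)
    (act : Dhat -> V -> V) (L : int -> V -> Prop) : Prop :=
  [/\ lie_module (Dpm e) act,
      direct_sum L,
      forall (j : int) u, (j < 0)%R -> L j u -> u = 0 &
      forall i j x u, Dpm_deg e i x -> L j u -> L (j - i) (act x u)].

Definition irreducible_hw_module (e : sign) (xi : Dhat -> K) (V : lmodType K)
    (act : Dhat -> V -> V) (L : int -> V -> Prop) (v : V) : Prop :=
  [/\ graded_module e act L, irreducible (Dpm e) act,
      [/\ v != 0, L 0 v &
        forall U, submodule (Dpm e) act U -> U v -> forall u, U u],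
      forall h, Dpm_deg e 0 h -> act h v = xi h *: v &
      forall j x, (0 < j)%R -> Dpm_deg e j x -> act x v = 0].

Definition finite_dim (V : lmodType K) (U : V -> Prop) : Prop :=
  exists (n : nat) (b : 'I_n -> V), (forall i, U (b i)) /\
    forall u, U u -> exists c : 'I_n -> K, u = \sum_(i < n) c i *: b i.

Definition quasifinite (V : lmodType K) (L : int -> V -> Prop) : Prop :=
  forall j, finite_dim (L j).

(* a : fps stands for \sum_n a n x^n, so fps_exp alpha is exp(alpha x), fps_sinh
   alpha is sinh(alpha x) and fps_poly p is p(x). *)
Definition fps : Type := nat -> K.

Definition fps_mul (a b : fps) : fps :=
  fun n => \sum_(i < n.+1) a i * b (n - i)%N.

Definition fps_poly (p : {poly K}) : fps := fun n => p`_n.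

Definition fps_exp (alpha : K) : fps := fun n => alpha ^+ n / n`!%:R.

Definition fps_sinh (alpha : K) : fps :=
  fun n => (fps_exp alpha n - fps_exp (- alpha) n) / 2%:R.

(* Quasipolynomials are identified with their Taylor series at 0. *)
Definition quasipolynomial (F : fps) : Prop :=
  exists s : seq ({poly K} * K),
    forall n, F n = \sum_(q <- s) fps_mul (fps_poly q.1) (fps_exp q.2) n.

(* F(-x) = F(x) *)
Definition fps_even (F : fps) : Prop := forall n, (-1) ^+ n * F n = F n.

Definition label (e : sign) (xi : Dhat -> K) (n : nat) : K :=
  match e with
  | Minus => - xi (tDhat 0 ('X ^+ n))
  | Plus => - xi (tDhat 0 (('X + (2%:R^-1)%:P) ^+ n))
  end.

Definition Delta (e : sign) (xi : Dhat -> K) : fps :=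
  fun n => if odd n then label e xi n / n`!%:R else 0.

(* a = F / b in the field of formal Laurent series, for b <> 0 *)
Definition fps_is_quotient (a F b : fps) : Prop :=
  forall n, fps_mul a b n = F n.

Definition two_sinh_half : fps := fun n => 2%:R * fps_sinh 2%:R^-1 n.

End Dhat.

(* Main.v *)
(* Let beta = (del - 1)/2 with del = 0 for the minus sign and 1 for the plus sign.
   The bracket of t h(D + beta + 1) and t^-1 g(D + beta) depends only on the even
   polynomial b = hg: it is theta(b) = b(D + beta) - b(D + beta + 1) + b(beta) C.
   The numbers xi(theta(w^n)), n even, have exponential generating function
   2 sinh(x/2) Delta(x) + xi(C) cosh(beta x), so F is a quasipolynomial exactly
   when they satisfy a linear recurrence, i.e. when xi(theta(g h)) = 0 for some
   g <> 0 and all even h.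
   If L is quasifinite, then some t^-1 g(D + beta) kills v, and applying
   t h(D + beta + 1) gives the recurrence.  Conversely, a recurrence makes
   t^-1 g(D + beta) v a singular vector, hence 0.  Bracketing with this operator
   yields, for every k > 0, some t^-k q(D) with q <> 0 that kills v, and then so
   does t^-k f(D) for all f divisible by q.  For an operator y of degree -i, the
   identity x y u = [x, y] u + y x u propagates this from v to every L_j: t^-k f(D)
   kills L_j as soon as f is divisible by some polynomial depending on k and j.
   Hence every L_j, a sum of images of the L_(j - k), is finite-dimensional. *)
Require Import Defs.
From mathcomp Require Import all_boot all_order all_algebra.
From mathcomp Require Import finmap monalg.
From mathcomp Require Import complex.
From mathcomp Require Import reals ring zify.

Set Implicit Arguments.
Unset Strict Implicit.
Unset Printing Implicit Defensive.

Import Order.TTheory GRing.Theory Num.Theory.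
Local Open Scope ring_scope.

(** * Linear recurrent sequences and their characteristic polynomials *)

Section Recurrence.
Variable K : fieldType.
Implicit Types (a b : nat -> K) (p q : {poly K}).

(** The linear functional on polynomials that sends ['X^n] to [a n]. *)
Definition pairing a p : K := \sum_(i < size p) p`_i * a i.

Lemma pairing_wide n a p : (size p <= n)%N ->
  pairing a p = \sum_(i < n) p`_i * a i.
Proof.
move=> le_pn; rewrite /pairing (big_ord_widen n (fun i => p`_i * a i)) //.
rewrite big_mkcond; apply: eq_bigr => i _; case: ltnP => // le_pi.
by rewrite nth_default ?mul0r.
Qed.

Lemma pairingP a c p q : pairing a (c *: p + q) = c * pairing a p + pairing a q.
Proof.
pose n := maxn (size p) (size q).
have le_p : (size p <= n)%N by rewrite leq_maxl.
have le_q : (size q <= n)%N by rewrite leq_maxr.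
have le_s : (size (c *: p + q)%R <= n)%N.
  apply: leq_trans (size_polyD _ _) _.
  by rewrite geq_max (leq_trans (size_scale_leq _ _)).
rewrite !(@pairing_wide n) // mulr_sumr -big_split /=; apply: eq_bigr => i _.
by rewrite coefD coefZ mulrDl mulrA.
Qed.

Lemma pairing0 a : pairing a 0 = 0.
Proof. by rewrite /pairing size_poly0 big_ord0. Qed.

Lemma pairingD a p q : pairing a (p + q) = pairing a p + pairing a q.
Proof. by rewrite -[p]scale1r pairingP mul1r scale1r. Qed.

Lemma pairingZ a c p : pairing a (c *: p) = c * pairing a p.
Proof. by rewrite -[c *: p]addr0 pairingP pairing0 addr0. Qed.

Lemma pairing_sum a (I : Type) (r : seq I) (F : I -> {poly K}) :
  pairing a (\sum_(i <- r) F i) = \sum_(i <- r) pairing a (F i).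
Proof. by apply: (big_morph _ (pairingD a) (pairing0 a)). Qed.

Lemma pairing_suml (I : Type) (r : seq I) (F : I -> nat -> K) p :
  pairing (fun n => \sum_(i <- r) F i n) p = \sum_(i <- r) pairing (F i) p.
Proof.
rewrite /pairing exchange_big /=; apply: eq_bigr => j _; exact: mulr_sumr.
Qed.

Lemma eq_pairing a b p : a =1 b -> pairing a p = pairing b p.
Proof. by move=> eab; apply: eq_bigr => i _; rewrite eab. Qed.

Lemma pairingZl c a p : pairing (fun n => c * a n) p = c * pairing a p.
Proof. by rewrite /pairing mulr_sumr; apply: eq_bigr => i _; rewrite mulrCA. Qed.

Lemma pairingXn a n : pairing a 'X^n = a n.
Proof.
rewrite /pairing size_polyXn big_ord_recr big1 /= => [|i _].
  by rewrite coefXn eqxx mul1r add0r.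
by rewrite coefXn (ltn_eqF (ltn_ord i)) mul0r.
Qed.

Lemma pairingXM a p : pairing a ('X * p) = pairing (fun n => a n.+1) p.
Proof.
rewrite (@pairing_wide (size p).+1); last first.
  by apply: leq_trans (size_polyMleq _ _) _; rewrite size_polyX.
rewrite big_ord_recl coefXM mul0r add0r.
by apply: eq_bigr => i _; rewrite coefXM.
Qed.

(** Multiplication by X - z is dual to the operator (shift - z) on sequences, so linear factors of a
    characteristic polynomial can be peeled off one by one. *)
Lemma pairing_XsubC z a p :
  pairing a (('X - z%:P) * p) = pairing (fun n => a n.+1 - z * a n) p.
Proof.
rewrite mulrDl pairingD pairingXM -polyCN mul_polyC pairingZ mulNr /pairing.
rewrite mulr_sumr -sumrB; apply: eq_bigr => i _.
by rewrite mulrBr (mulrCA z).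
Qed.

(* [annih p a] says that [a] satisfies the linear recurrence with
   characteristic polynomial [p]. *)
Definition annih p a := forall q, pairing a (p * q) = 0.

Lemma annih_mulr p q a : annih p a -> annih (p * q) a.
Proof. by move=> pa r; rewrite -mulrA. Qed.

Lemma annih_mull p q a : annih p a -> annih (q * p) a.
Proof. by rewrite mulrC; apply: annih_mulr. Qed.

Lemma eq_annih p a b : a =1 b -> annih p a -> annih p b.
Proof. by move=> eab pa q; rewrite -(eq_pairing _ eab). Qed.

Lemma annih_XsubC z p a :
  annih (('X - z%:P) * p) a <-> annih p (fun n => a n.+1 - z * a n).
Proof. by split=> pa q; have := pa q; rewrite -mulrA pairing_XsubC. Qed.

Lemma annihD p a b : annih p a -> annih p b -> annih p (fun n => a n + b n).
Proof.
move=> pa pb q; transitivity (pairing a (p * q) + pairing b (p * q)).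
  by rewrite /pairing -big_split; apply: eq_bigr => i _; rewrite mulrDr.
by rewrite pa pb addr0.
Qed.

Lemma annih_sum (I : Type) (r : seq I) (F : I -> nat -> K) p :
  (forall i, annih p (F i)) -> annih p (fun n => \sum_(i <- r) F i n).
Proof. by move=> pF q; rewrite pairing_suml big1 // => i _; apply: pF. Qed.

(** The sequence with exponential generating function x^j e^(z x) / j!. For n < j the binomial
    coefficient vanishes, so the truncated exponent is harmless. *)
Definition binexp j (z : K) : nat -> K := fun n => 'C(n, j)%:R * z ^+ (n - j).

Lemma binexp0_step z n : binexp 0 z n.+1 - z * binexp 0 z n = 0.
Proof. by rewrite /binexp !bin0 !mul1r !subn0 exprS subrr. Qed.

(** By Pascal's rule, shift - z lowers [j] by one. *)
Lemma binexp_step j z n :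
  binexp j.+1 z n.+1 - z * binexp j.+1 z n = binexp j z n.
Proof.
rewrite /binexp binS subSS natrD mulrDl.
have [lt_nj|lt_jn] := leqP n j; last first.
  by rewrite -(subnSK lt_jn) exprS; ring.
by rewrite bin_small ?ltnS // !mul0r mulr0 subr0 add0r.
Qed.

Lemma annih_binexp j z : annih (('X - z%:P) ^+ j.+1) (binexp j z).
Proof.
elim: j => [|j IHj]; rewrite exprS; apply/annih_XsubC.
  by move=> q; rewrite /pairing big1 // => i _; rewrite binexp0_step mulr0.
by apply: eq_annih IHj => n; rewrite binexp_step.
Qed.

End Recurrence.

(** * Quasipolynomials as generating functions of linear recurrent sequences *)

Section Quasipolynomial.
Variable K : numClosedFieldType.
Implicit Types (a b : nat -> K) (p : {poly K}).

Definition egf a : fps K := fun n => a n / n`!%:R.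

Lemma fact_neq0 n : n`!%:R != 0 :> K.
Proof. by rewrite pnatr_eq0 -lt0n fact_gt0. Qed.

(** The series x^i e^(z x) is i! times the generating function of [binexp i z]. The two summation
    ranges agree because the coefficients of [p] vanish beyond its size, and [binexp i z n] vanishes
    for i > n. *)
Lemma fact_poly_exp p z n :
  n`!%:R * fps_mul (fps_poly p) (fps_exp z) n
  = \sum_(i < size p) (p`_i * i`!%:R) * binexp i z n.
Proof.
rewrite /fps_mul /fps_poly /fps_exp mulr_sumr.
transitivity (\sum_(i < n.+1) p`_i * i`!%:R * binexp i z n).
  apply: eq_bigr => i _; rewrite /binexp.
  have le_in : (i <= n)%N by rewrite -ltnS.
  have := bin_fact le_in; move: (fact_neq0 (n - i)) (fact_neq0 i) => h1 h2.
  by move=> <-; rewrite !natrM; field.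
have [le_pn|lt_np] := leqP (size p) n.+1.
  rewrite (big_ord_widen _ (fun i => p`_i * i`!%:R * binexp i z n) le_pn).
  rewrite [RHS]big_mkcond; apply: eq_bigr => i _; case: ltnP => // le_pi.
  by rewrite nth_default ?mul0r.
rewrite (big_ord_widen _ (fun i => p`_i * i`!%:R * binexp i z n) (ltnW lt_np)).
rewrite [LHS]big_mkcond; apply: eq_bigr => i _; case: ltnP => // le_ni.
by rewrite /binexp bin_small ?mul0r ?mulr0.
Qed.

Lemma eq_quasipolynomial (F G : fps K) :
  F =1 G -> quasipolynomial F -> quasipolynomial G.
Proof. by move=> eFG [s Fs]; exists s => n; rewrite -eFG. Qed.

Lemma quasipolynomialD (F G : fps K) : quasipolynomial F -> quasipolynomial G ->
  quasipolynomial (fun n => F n + G n).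
Proof.
move=> [s Fs] [t Gt]; exists (s ++ t) => n; by rewrite big_cat /= Fs Gt.
Qed.

Lemma quasipolynomialZ c (F : fps K) :
  quasipolynomial F -> quasipolynomial (fun n => c * F n).
Proof.
move=> [s Fs]; exists [seq (c *: q.1, q.2) | q <- s] => n.
rewrite big_map Fs mulr_sumr; apply: eq_bigr => q _ /=.
rewrite /fps_mul mulr_sumr; apply: eq_bigr => i _.
by rewrite /fps_poly coefZ mulrA.
Qed.

Lemma quasipolynomial_binexp j z : quasipolynomial (egf (binexp j z)).
Proof.
exists [:: (j`!%:R^-1 *: 'X^j, z)]; move=> n; rewrite big_seq1 /=.
apply: (mulfI (fact_neq0 n)); rewrite fact_poly_exp /egf.
rewrite size_scale ?invr_eq0 ?fact_neq0 // size_polyXn big_ord_recr big1 /= => [|i _].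
  rewrite coefZ coefXn eqxx mulr1 mulVf ?fact_neq0 // mul1r add0r.
  by rewrite mulrC divfK ?fact_neq0.
by rewrite coefZ coefXn (ltn_eqF (ltn_ord i)) mulr0 !mul0r.
Qed.

(** In the resonant case z = y, [binexp j.+1 y] is a solution. Otherwise shift - y = (shift - z) +
    (z - y) is triangular on the sequences [binexp i z] with diagonal entry z - y, and is inverted
    by induction on [j]. *)
Lemma solve_binexp y j z : exists2 a, quasipolynomial (egf a) &
  forall n, a n.+1 - y * a n = binexp j z n.
Proof.
have [->|neq_zy] := eqVneq z y.
  by exists (binexp j.+1 y) => [|n]; [exact: quasipolynomial_binexp | exact: binexp_step].
have zy : z - y != 0 by rewrite subr_eq0.
elim: j => [|j [a qa aP]].
  exists (fun n => (z - y)^-1 * binexp 0 z n) => [|n].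
    apply: (eq_quasipolynomial _ (quasipolynomialZ (z - y)^-1
      (quasipolynomial_binexp 0 z))) => n.
    by rewrite /egf mulrA.
  by have /eqP := binexp0_step z n; rewrite subr_eq0 => /eqP ->; field.
exists (fun n => (z - y)^-1 * (binexp j.+1 z n - a n)) => [|n].
  have qb := quasipolynomial_binexp j.+1 z.
  apply: (eq_quasipolynomial _ (quasipolynomialZ (z - y)^-1
    (quasipolynomialD qb (quasipolynomialZ (-1) qa)))) => n.
  by rewrite /egf; move: (fact_neq0 n) => nz; field; rewrite nz zy.
have /eqP := binexp_step j z n; rewrite subr_eq => /eqP ->.
by move/eqP: (aP n); rewrite subr_eq => /eqP ->; field.
Qed.

Lemma solve_quasipolynomial y b : quasipolynomial (egf b) ->
  exists2 a, quasipolynomial (egf a) & forall n, a n.+1 - y * a n = b n.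
Proof.
have solve0 : exists2 a, quasipolynomial (egf a) &
    forall n, a n.+1 - y * a n = 0.
  exists (fun=> 0) => [|n]; last by rewrite mulr0 subrr.
  by exists [::] => n; rewrite big_nil /egf mul0r.
have solveD b1 b2 : (exists2 a, quasipolynomial (egf a) &
      forall n, a n.+1 - y * a n = b1 n) -> (exists2 a, quasipolynomial (egf a) &
      forall n, a n.+1 - y * a n = b2 n) -> exists2 a, quasipolynomial (egf a) &
      forall n, a n.+1 - y * a n = b1 n + b2 n.
  move=> [a1 q1 e1] [a2 q2 e2]; exists (fun n => a1 n + a2 n) => [|n].
    apply: (eq_quasipolynomial _ (quasipolynomialD q1 q2)) => n.
    by rewrite /egf mulrDl.
  by rewrite -e1 -e2; ring.
have solveZ c j z : exists2 a, quasipolynomial (egf a) &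
    forall n, a n.+1 - y * a n = c * binexp j z n.
  have [a qa e] := solve_binexp y j z; exists (fun n => c * a n) => [|n].
    apply: (eq_quasipolynomial _ (quasipolynomialZ c qa)) => n.
    by rewrite /egf mulrA.
  by rewrite -e; ring.
move=> [s bs].
suff [a qa e] : exists2 a, quasipolynomial (egf a) & forall n, a n.+1 - y * a n =
    \sum_(q <- s) n`!%:R * fps_mul (fps_poly q.1) (fps_exp q.2) n.
  exists a => // n; rewrite e -mulr_sumr -bs /egf mulrC divfK ?fact_neq0 //.
elim: s {bs} => [|[p z] s IHs].
  by have [a qa e] := solve0; exists a => // n; rewrite e big_nil.
have solve_p m : exists2 a, quasipolynomial (egf a) & forall n,
    a n.+1 - y * a n = \sum_(i < m) (p`_i * i`!%:R) * binexp i z n.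
  elim: m => [|m IHm].
    by have [a qa e] := solve0; exists a => // n; rewrite e big_ord0.
  have [a qa e] := solveD _ _ IHm (solveZ (p`_m * m`!%:R) m z).
  by exists a => // n; rewrite e big_ord_recr.
have [a qa e] := solveD _ _ (solve_p (size p)) IHs.
by exists a => // n; rewrite e big_cons fact_poly_exp.
Qed.

(** Induction on the roots of [p]: after removing a root z, the sequence a(n+1) - z a(n) is covered
    by the induction hypothesis, and a first-order recurrence remains to be solved. *)
Lemma quasipolynomial_annih a p : p != 0 -> annih p a -> quasipolynomial (egf a).
Proof.
have [r ->] := closed_field_poly_normal p.
rewrite scaler_eq0 lead_coef_eq0 negb_or => /andP[lc_n0 _] pa.
have {pa}: annih (\prod_(z <- r) ('X - z%:P)) a.
  move=> q; have := pa ((lead_coef p)^-1 *: q).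
  by rewrite -scalerAl -scalerAr scalerA divff ?lead_coef_eq0 // scale1r.
elim: r a => [|z r IHr] a.
  rewrite big_nil => a0; exists [::] => n; rewrite big_nil.
  by have := a0 'X^n; rewrite mul1r pairingXn /egf => ->; rewrite mul0r.
rewrite big_cons => /annih_XsubC /IHr /(solve_quasipolynomial z)[b qb bP].
(* Two solutions of the same first-order recurrence differ by a multiple of z^n, which is fixed by
   the values at 0. *)
have qz := quasipolynomialZ (a 0%N - b 0%N) (quasipolynomial_binexp 0 z).
apply: (eq_quasipolynomial _ (quasipolynomialD qb qz)) => n.
rewrite /egf mulrA -mulrDl; congr (_ / _).
rewrite /binexp; elim: n => [|n IHn]; first by rewrite bin0 subn0 !mulr1 addrC subrK.
have -> : a n.+1 = b n.+1 - z * b n + z * a n by rewrite bP subrK.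
by rewrite -IHn !bin0 !subn0 exprS; ring.
Qed.

Lemma annih_quasipolynomial a :
  quasipolynomial (egf a) -> exists2 p, p != 0 & annih p a.
Proof.
move=> [s as_].
have ea n : a n = \sum_(q <- s) n`!%:R * fps_mul (fps_poly q.1) (fps_exp q.2) n.
  by rewrite -mulr_sumr -as_ /egf mulrC divfK ?fact_neq0.
(* The term p(x) e^(z x) involves [binexp i z] only for i < [size p], and (X - z)^(size p)
   annihilates all of these. *)
exists (\prod_(q <- s) ('X - q.2%:P) ^+ (size q.1)).
  by rewrite prodf_seq_neq0; apply/allP => q _; rewrite expf_neq0 ?polyXsubC_eq0.
apply: (@eq_annih _ _ (fun n =>
  \sum_(q <- s) n`!%:R * fps_mul (fps_poly q.1) (fps_exp q.2) n)) => [n|].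
  by rewrite ea.
elim: s {as_ ea} => [|[p z] s IHs].
  by move=> q; rewrite pairing_suml; apply: big_nil.
pose b n := n`!%:R * fps_mul (fps_poly p) (fps_exp z) n.
apply: (@eq_annih _ _ (fun n => b n +
  \sum_(q <- s) n`!%:R * fps_mul (fps_poly q.1) (fps_exp q.2) n)) => [n|].
  by rewrite big_cons.
rewrite big_cons /=; apply: annihD; last exact: annih_mull IHs.
apply: annih_mulr.
apply: (@eq_annih _ _ (fun n => \sum_(i < size p) (p`_i * i`!%:R) * binexp i z n)) => [n|].
  by rewrite /b fact_poly_exp.
apply: annih_sum => -[i /= lt_ip] q; rewrite pairingZl -(subnK lt_ip) exprD.
by rewrite annih_mull ?mulr0 //; apply: annih_binexp.
Qed.

End Quasipolynomial.

(** * Homogeneous elements of the two subalgebras, described by a reflection symmetry *)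

Section Operators.
Variable K : numFieldType.
Implicit Types (f g : {poly K}) (r s k : int) (e : sign) (x y : Dhat K).

Lemma pshiftM (c : K) f g : pshift c (f * g) = pshift c f * pshift c g.
Proof. exact: comp_polyM. Qed.

Lemma pshiftD (c : K) f g : pshift c (f + g) = pshift c f + pshift c g.
Proof. exact: comp_polyD. Qed.

Lemma pshiftZ (c a : K) f : pshift c (a *: f) = a *: pshift c f.
Proof. exact: comp_polyZ. Qed.

Lemma pshift_pshift (c d : K) f : pshift c (pshift d f) = pshift (c + d) f.
Proof.
rewrite /pshift -comp_polyA comp_polyD comp_polyX comp_polyC polyCD.
by rewrite addrA.
Qed.

Lemma pshift0 f : pshift 0 f = f.
Proof. by rewrite /pshift polyC0 addr0 comp_polyXr. Qed.

Lemma pshift_eq0 (c : K) f : (pshift c f == 0) = (f == 0).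
Proof.
apply/eqP/eqP => [cf0|->]; last by rewrite /pshift comp_poly0.
by rewrite -[f]pshift0 -(addNr c) -pshift_pshift cf0 /pshift comp_poly0.
Qed.

Lemma horner_pshift (c z : K) f : (pshift c f).[z] = f.[z + c].
Proof. by rewrite horner_comp hornerD hornerX hornerC. Qed.

Lemma dvdp_pshift (c : K) f g : f %| g -> pshift c f %| pshift c g.
Proof. by move=> /dvdpP[h ->]; rewrite pshiftM dvdp_mull. Qed.

(* The parameter that is 0 for the minus sign and 1 for the plus sign, so that
   the degree k operators are t^k g(D + (k + del e)/2). *)
Definition del e : int := if e is Plus then 1 else 0.

(** The substitution w -> -w - (k + del), the reflection about the point -(k + del)/2. *)
Definition refl e k : {poly K} := - 'X - ((k + del e)%:~R)%:P.

Definition psign e k : K :=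
  if e is Minus then (if (2 %| k)%Z then -1 else 1) else -1.

(** Membership of t^k f(D) in the subalgebra as a symmetry of [f] itself, instead of the parity of a
    shifted polynomial; [admP] gives the equivalence. *)
Definition adm e k f := f \Po refl e k = psign e k *: f.

Lemma Dpm_shiftE e k : Dpm_shift K e k = (k + del e)%:~R / 2%:R.
Proof. by case: e => //=; rewrite addr0. Qed.

Lemma Dpm_parityE e k f : Dpm_parity e k f <-> f \Po (- 'X) = psign e k *: f.
Proof.
by case: e => /=; [case: ifP => _|]; rewrite ?scale1r ?scaleN1r.
Qed.

Lemma half_plus_half (c : K) : c / 2%:R + c / 2%:R = c.
Proof. by field. Qed.

Lemma reflE e k : pshift (Dpm_shift K e k) (- 'X) = refl e k + (Dpm_shift K e k)%:P.
Proof.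
rewrite /refl -[(k + del e)%:~R]half_plus_half -Dpm_shiftE /pshift polyCD.
by rewrite raddfN /= comp_polyX; ring.
Qed.

Lemma comp_refl e k f :
  pshift (Dpm_shift K e k) f \Po refl e k = pshift (Dpm_shift K e k) (f \Po (- 'X)).
Proof.
rewrite /pshift -!comp_polyA comp_polyD comp_polyX comp_polyC -reflE.
by [].
Qed.

Lemma pshiftNK (c : K) f : pshift c (pshift (- c) f) = f.
Proof. by rewrite pshift_pshift subrr pshift0. Qed.

Lemma pshift_inj (c : K) : injective (pshift c : {poly K} -> {poly K}).
Proof.
by move=> f g /(congr1 (pshift (- c))); rewrite !pshift_pshift addNr !pshift0.
Qed.

Lemma reflP e k (a : K) f : pshift (Dpm_shift K e k) f \Po refl e k =
  a *: pshift (Dpm_shift K e k) f <-> f \Po (- 'X) = a *: f.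
Proof.
rewrite comp_refl -pshiftZ; split=> [/pshift_inj //|->]; by [].
Qed.

Lemma admP e k f :
  (exists2 g, Dpm_parity e k g & f = pshift (Dpm_shift K e k) g) <-> adm e k f.
Proof.
split=> [[g /Dpm_parityE gP ->]|fP]; first exact/reflP.
exists (pshift (- Dpm_shift K e k) f); last by rewrite pshiftNK.
by apply/Dpm_parityE/(reflP e k); rewrite pshiftNK.
Qed.

Lemma adm0 e k : adm e k 0.
Proof. by rewrite /adm comp_poly0 scaler0. Qed.

Lemma admP_lin e k (a : K) f g : adm e k f -> adm e k g -> adm e k (a *: f + g).
Proof.
by rewrite /adm comp_polyD comp_polyZ => -> ->; rewrite scalerDr !scalerA mulrC.
Qed.

Lemma psignD e r s : psign e (r + s) = - (psign e r * psign e s).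
Proof.
case: e; rewrite /psign; last by rewrite mulrNN mulr1.
case: ifP; case: ifP; case: ifP => ? ? ?;
  rewrite ?mulrNN ?mulN1r ?mulrN1 ?mulr1 ?opprK //; exfalso; lia.
Qed.

Lemma refl_refl e k : refl e k \Po refl e k = 'X.
Proof. by rewrite {1}/refl comp_polyB raddfN /= comp_polyX comp_polyC /refl; ring. Qed.

Lemma psign_sqr e k : psign e k * psign e k = 1.
Proof. by rewrite /psign; case: e => //=; [case: ifP => _|]; rewrite ?mulrNN mulr1. Qed.

(** The reflection for degree r + s exchanges f(D+s) g(D) and f(D) g(D+r) up to the factor
    [psign e r * psign e s], and by [psignD] the sign required in degree r + s is the opposite of
    that factor. *)
Lemma adm_bracket e r s f g : adm e r f -> adm e s g ->
  adm e (r + s) (pshift s%:~R f * g - f * pshift r%:~R g).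
Proof.
move=> fP gP; rewrite /adm comp_polyB !comp_polyM.
have -> : pshift s%:~R f \Po refl e (r + s) = psign e r *: f.
  rewrite -fP /pshift -comp_polyA comp_polyD comp_polyX comp_polyC; congr (_ \Po _).
  by rewrite /refl !intrD !polyCD; ring.
have -> : g \Po refl e (r + s) = psign e s *: pshift r%:~R g.
  rewrite -pshiftZ -gP /pshift -comp_polyA; congr (_ \Po _).
  rewrite /refl !intrD comp_polyB raddfN /= comp_polyX comp_polyC !polyCD.
  by ring.
have -> : f \Po refl e (r + s) = psign e r *: pshift s%:~R f.
  rewrite -pshiftZ -fP /pshift -comp_polyA; congr (_ \Po _).
  rewrite /refl !intrD comp_polyB raddfN /= comp_polyX comp_polyC !polyCD.
  by ring.
have -> : pshift r%:~R g \Po refl e (r + s) = psign e s *: g.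
  rewrite -gP /pshift -comp_polyA comp_polyD comp_polyX comp_polyC; congr (_ \Po _).
  by rewrite /refl !intrD !polyCD; ring.
rewrite psignD -!scalerAl -!scalerAr !scalerA scaleNr scalerBr opprB.
by [].
Qed.

Lemma Dpm_adm e x : Dpm e x <-> forall k, adm e k (x.1@_k).
Proof.
by split=> xP k; have /admP := xP k.
Qed.

Lemma DpmP e a x y : Dpm e x -> Dpm e y -> Dpm e (a *: x + y).
Proof.
move=> /Dpm_adm xP /Dpm_adm yP; apply/Dpm_adm => k.
have -> : (a *: x + y).1@_k = a *: x.1@_k + y.1@_k.
  by rewrite /= mcoeffD mcoeffZ mul_polyC.
exact: admP_lin.
Qed.

Lemma Dpm0 e : Dpm e (0 : Dhat K).
Proof. by apply/Dpm_adm => k; rewrite mcoeff0; apply: adm0. Qed.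

Lemma Dpm_degP e k x : Dpm_deg e k x <->
  exists f c, [/\ adm e k f, k != 0 -> c = 0 & x = (tD k f, c)].
Proof.
split=> [[/Dpm_adm xP [x0 xc]]|[f [c [fP c0 ->]]]].
  exists x.1@_k, x.2; split=> //; case: x {xP xc} x0 => x1 x2 /= x0.
  congr pair; apply/malgP => r; rewrite /tD mcoeffU.
  by case: eqVneq => [->|/= neq]; [rewrite mulr1n | rewrite mulr0n x0 // eq_sym].
split; first apply/Dpm_adm => r; last split=> [r neq|] //=.
  rewrite /tD /= mcoeffU; case: eqVneq => [<-|_]; first by rewrite mulr1n.
  by rewrite mulr0n; apply: adm0.
by rewrite /tD mcoeffU eq_sym (negPf neq).
Qed.

Lemma Dpm_deg_tDhat e k f : adm e k f -> Dpm_deg e k (tDhat k f).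
Proof. by move=> fP; apply/Dpm_degP; exists f, 0. Qed.

Lemma tDhatP (a : K) k f g : tDhat k (a *: f + g) = a *: tDhat k f + tDhat k g.
Proof.
congr pair; last by rewrite /= scaler0 addr0.
rewrite /tD monalgUD; congr (_ + _); apply/malgP => r.
by rewrite mcoeffZ !mcoeffU mulrnAr mul_polyC.
Qed.

Lemma bracketE r f (c : K) s g (d : K) :
  bracket ((tD r f, c) : Dhat K) ((tD s g, d) : Dhat K)
  = (Dbr1 r f s g, Psi1 r f s g).
Proof. exact: bracket_tDhat. Qed.

Lemma bracket_neq0 r f (c : K) s g (d : K) : r + s != 0 ->
  bracket ((tD r f, c) : Dhat K) ((tD s g, d) : Dhat K)
  = tDhat (r + s) (pshift s%:~R f * g - f * pshift r%:~R g).
Proof. by move=> /negPf rs0; rewrite bracketE /Psi1 rs0. Qed.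

Lemma Dpm_deg_bracket e r s x y : Dpm_deg e r x -> Dpm_deg e s y ->
  Dpm_deg e (r + s) (bracket x y).
Proof.
move=> /Dpm_degP[f [c [fP _ ->]]] /Dpm_degP[g [d [gP _ ->]]].
apply/Dpm_degP; rewrite bracketE.
exists (pshift s%:~R f * g - f * pshift r%:~R g), (Psi1 r f s g); split=> //.
  exact: adm_bracket.
by rewrite /Psi1 => /negPf ->.
Qed.

Lemma Dhat_decomp x : x = \sum_(k <- msupp x.1) tDhat k x.1@_k + (tD 0 0, x.2).
Proof.
case: x => x1 x2; have fstD (s : seq int) (F : int -> Dhat K) :
    \sum_(i <- s) F i = (\sum_(i <- s) (F i).1, \sum_(i <- s) (F i).2).
  by elim: s => [|i s IHs]; rewrite ?big_nil // !big_cons IHs.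
rewrite fstD; congr pair; last by rewrite /= big1 // add0r.
by rewrite /tD monalgU0 addr0 -monalgE.
Qed.

End Operators.

Arguments refl {K} e k.
Arguments psign {K} e k.

(** * Graded modules and their submodules *)

Section GradedModule.
Variables (K : numFieldType) (e : sign) (V : lmodType K).
Variables (act : Dhat K -> V -> V) (L : int -> V -> Prop).
Hypothesis gradedL : graded_module e act L.
Implicit Types (i j k : int) (x y : Dhat K) (u w : V).

Lemma actP (a : K) x y u : Dpm e x -> Dpm e y ->
  act (a *: x + y) u = a *: act x u + act y u.
Proof. by case: gradedL => -[+ _ _] _ _ _; apply. Qed.

Lemma act_linr x (a : K) u w : Dpm e x ->
  act x (a *: u + w) = a *: act x u + act x w.
Proof. by case: gradedL => -[_ + _] _ _ _; apply. Qed.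

Lemma act_bracket x y u : Dpm e x -> Dpm e y ->
  act (bracket x y) u = act x (act y u) - act y (act x u).
Proof. by case: gradedL => -[_ _ +] _ _ _; apply. Qed.

Lemma act0l u : act 0 u = 0.
Proof.
have := actP 1 u (@Dpm0 K e) (@Dpm0 K e).
by rewrite scaler0 addr0 scale1r => /eqP; rewrite -subr_eq0 opprD addNKr oppr_eq0 => /eqP.
Qed.

Lemma act0r x : Dpm e x -> act x 0 = 0.
Proof.
move=> xP; have := act_linr 1 0 0 xP.
by rewrite scaler0 addr0 scale1r => /eqP; rewrite -subr_eq0 opprD addNKr oppr_eq0 => /eqP.
Qed.

Lemma actDr x u w : Dpm e x -> act x (u + w) = act x u + act x w.
Proof. by move=> xP; rewrite -[u]scale1r act_linr // !scale1r. Qed.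

Lemma actZr x (a : K) u : Dpm e x -> act x (a *: u) = a *: act x u.
Proof. by move=> xP; rewrite -[a *: u]addr0 act_linr // act0r // addr0. Qed.

Lemma actDl x y u : Dpm e x -> Dpm e y -> act (x + y) u = act x u + act y u.
Proof. by move=> xP yP; rewrite -[x]scale1r actP // !scale1r. Qed.

Lemma Dpm_deg_Dpm k x : Dpm_deg e k x -> Dpm e x.
Proof. by case. Qed.

Lemma L_subspace j : subspace (L j).
Proof. by case: gradedL => _ [+ _ _] _ _; apply. Qed.

Lemma L0 j : L j 0. Proof. by case: (L_subspace j). Qed.

Lemma LP j (a : K) u w : L j u -> L j w -> L j (a *: u + w).
Proof. by case: (L_subspace j) => _; apply. Qed.

Lemma L_neg j u : (j < 0)%R -> L j u -> u = 0.
Proof. by case: gradedL => _ _ + _; apply. Qed.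

Lemma L_act i j x u : Dpm_deg e i x -> L j u -> L (j - i) (act x u).
Proof. by case: gradedL => _ _ _; apply. Qed.

(** Reduction of an arbitrary operator to its homogeneous components. *)
Lemma act_deg_ind (P : V -> Prop) x u : P 0 -> (forall v w, P v -> P w -> P (v + w)) ->
  (forall k y, Dpm_deg e k y -> P (act y u)) -> Dpm e x -> P (act x u).
Proof.
move=> P0 PD Pdeg /Dpm_adm xP; rewrite (Dhat_decomp x).
have yP k : Dpm e (tDhat k x.1@_k).
  exact: Dpm_deg_Dpm (Dpm_deg_tDhat (xP k)).
have cP : Dpm_deg e 0 ((tD 0 0, x.2) : Dhat K).
  by apply/Dpm_degP; exists 0, x.2; split=> //; apply: adm0.
have [+ _] : P (act (\sum_(k <- msupp x.1) tDhat k x.1@_k) u) /\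
             Dpm e (\sum_(k <- msupp x.1) tDhat k x.1@_k).
  elim/big_ind: _ => [|y z [Py yQ] [Pz zQ]|k _].
  - by split; [rewrite act0l | apply: Dpm0].
  - split; first by rewrite actDl //; apply: PD.
    by rewrite -[y]scale1r; apply: DpmP.
  - by split=> //; apply: Pdeg (Dpm_deg_tDhat (xP k)).
have sP : Dpm e (\sum_(k <- msupp x.1) tDhat k x.1@_k).
  elim/big_ind: _ => [|y z yQ zQ|k _] //; first exact: Dpm0.
  by rewrite -[y]scale1r; apply: DpmP.
move=> Ps; rewrite actDl //; last exact: Dpm_deg_Dpm cP.
exact: PD Ps (Pdeg _ _ cP).
Qed.

(* The graded subspace obtained by applying operators of negative degree to the
   vectors of B, which are placed in degree j0. *)
Inductive descend j0 (B : V -> Prop) : int -> V -> Prop :=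
| descend_base u : B u -> descend j0 B j0 u
| descend_zero j : descend j0 B j 0
| descend_lin j (a : K) u w :
    descend j0 B j u -> descend j0 B j w -> descend j0 B j (a *: u + w)
| descend_act i j x u : (0 < i)%R -> Dpm_deg e (- i) x ->
    descend j0 B j u -> descend j0 B (j + i) (act x u).

(** * The submodule generated by singular vectors of one degree *)

Section Descend.
Variables (j0 : int) (B : V -> Prop).
Hypothesis B_L : forall u, B u -> L j0 u.
Hypothesis B_zero : forall x u, Dpm_deg e 0 x -> B u -> B (act x u).
Hypothesis B_pos : forall i x u, (0 < i)%R -> Dpm_deg e i x -> B u -> act x u = 0.
Let W := descend j0 B.

Lemma descend_deg_eq j k u : j = k -> W j u -> W k u.
Proof. by move=> ->. Qed.

Lemma descendD j u w : W j u -> W j w -> W j (u + w).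
Proof. by move=> Wu Ww; rewrite -[u]scale1r; apply: descend_lin. Qed.

(** Operators of negative degree only raise the index, so nothing non-zero appears below [j0]. This
    later keeps the highest weight vector out of a submodule generated in degree 1. *)
Lemma descend_sub j u : W j u -> L j u /\ ((j < j0)%R -> u = 0).
Proof.
elim=> {j u} [u Bu|j|j a u w _ [Lu u0] _ [Lw w0]|i j x u i0 xP _ [Lu u0]].
- by split; [apply: B_L | rewrite ltxx].
- by split=> //; apply: L0.
- split=> [|lt_j]; first exact: LP.
  by rewrite u0 // w0 // scaler0 addr0.
- split=> [|lt_j]; first by have := L_act xP Lu; rewrite opprK.
  rewrite u0; first by apply: act0r; apply: Dpm_deg_Dpm xP.
  by lia.
Qed.

(* Operators of nonnegative degree are moved to the right by commutation. *)
Lemma descend_act_nonneg j u : W j u ->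
  forall i x, (0 <= i)%R -> Dpm_deg e i x -> W (j - i) (act x u).
Proof.
elim=> {j u} [u Bu|j|j a u w _ IHu _ IHw|k j y u k0 yP Wu IHu] i x i0 xP.
- have [i_gt0|] := ltrP 0 i; first by rewrite (B_pos i_gt0 xP Bu); apply: descend_zero.
  move=> i_le0; have {}i0 : i = 0 by lia.
  by rewrite i0 in xP *; rewrite subr0; apply: descend_base; apply: B_zero.
- by rewrite act0r; [apply: descend_zero | apply: Dpm_deg_Dpm xP].
- rewrite act_linr; last exact: Dpm_deg_Dpm xP.
  by apply: descend_lin; [apply: IHu | apply: IHw].
have := act_bracket u (Dpm_deg_Dpm xP) (Dpm_deg_Dpm yP).
move=> /esym/eqP; rewrite subr_eq => /eqP ->; apply: descendD; last first.
  by apply: (@descend_deg_eq (j - i + k)); [lia | apply: descend_act => //; apply: IHu].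
have bP := Dpm_deg_bracket xP yP.
have [ge0|lt0] := lerP 0 (i - k).
  by apply: (@descend_deg_eq (j - (i - k))); [lia | apply: IHu].
apply: (@descend_deg_eq (j + (k - i))); first by lia.
by apply: descend_act => //; [lia | rewrite opprB].
Qed.

Lemma descend_act_deg j u i x : W j u -> Dpm_deg e i x -> W (j - i) (act x u).
Proof.
move=> Wu xP; have [i0|i0] := lerP 0 i; first exact: descend_act_nonneg.
by apply: descend_act; rewrite ?oppr_gt0 ?opprK.
Qed.

(** The sum of all graded pieces as a plain subspace, the form that the definition of a submodule
    asks for. *)
Inductive descend_span : V -> Prop :=
| descend_span0 : descend_span 0
| descend_spanD j w u : W j w -> descend_span u -> descend_span (w + u).

Lemma descend_spanP (a : K) u w :
  descend_span u -> descend_span w -> descend_span (a *: u + w).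
Proof.
move=> Su Sw; elim: Su => [|j y z Wy _ IH]; first by rewrite scaler0 add0r.
rewrite scalerDr -addrA; apply: (descend_spanD (j := j)) => //.
by rewrite -[a *: y]addr0; apply: descend_lin => //; apply: descend_zero.
Qed.

Lemma descend_submodule : submodule (Dpm e) act descend_span.
Proof.
split; first by split; [apply: descend_span0 | apply: descend_spanP].
have SD u w : descend_span u -> descend_span w -> descend_span (u + w).
  by move=> Su Sw; rewrite -[u]scale1r; apply: descend_spanP.
move=> x u xP; elim=> [|j w {}u Ww _ IH]; first by rewrite act0r //; apply: descend_span0.
rewrite actDr //; apply: (SD) => //.
apply: act_deg_ind xP => [|y z|k y yP]; first exact: descend_span0.
  exact: SD.
rewrite -[act y w]addr0; apply: descend_spanD descend_span0.
exact: descend_act_deg Ww yP.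
Qed.

Lemma descend_span_sum u : descend_span u ->
  exists s (w : int -> V), [/\ uniq s, forall j, W j (w j) & u = \sum_(j <- s) w j].
Proof.
elim=> [|k y {}u Wy _ [s [w [us Ww ->]]]].
  by exists [::], (fun=> 0); split=> //; [move=> j; apply: descend_zero | rewrite big_nil].
have [ks|ks] := boolP (k \in s).
  exists s, (fun j => if j == k then y + w j else w j); split=> // [j|].
    by case: eqVneq => [->|] //; apply: descendD.
  rewrite (bigD1_seq k) //= [in RHS](bigD1_seq k) //= eqxx addrA; congr (_ + _).
  by apply: eq_bigr => j /negPf ->.
exists (k :: s), (fun j => if j == k then y else w j); split=> /= [|j|].
- by rewrite ks.
- by case: eqVneq => [->|].
rewrite big_cons eqxx; congr (_ + _); rewrite big_seq [RHS]big_seq.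
by apply: eq_bigr => j js; case: eqVneq => // jk; rewrite -jk js in ks.
Qed.

Lemma descend_span_homog j u : descend_span u -> L j u -> W j u.
Proof.
move=> /descend_span_sum[s [w [us Ww ->]]] Lu.
have WL k : L k (w k) by case: (descend_sub (Ww k)).
have [_ _ direct] : direct_sum L by case: gradedL.
(* The family [d] is the decomposition [w] minus the vector itself placed in degree [j]. It sums to
   zero, so directness makes it vanish at [j]; the index [j] is added to the list in case it is
   missing. *)
pose t := if j \in s then s else j :: s.
have ut : uniq t by rewrite /t; case: ifP => //= ->.
have jt : j \in t by rewrite /t; case: ifP => // _; rewrite mem_head.
pose z := \sum_(k <- s) w k.
pose d k := (if k \in s then w k else 0) - (if k == j then z else 0).
have dL k : L k (d k).
  rewrite /d addrC -scaleN1r; apply: LP; last by case: ifP => // _; apply: L0.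
  by case: eqVneq => [->|_] //; apply: L0.
have sum_d : \sum_(k <- t) d k = 0.
  rewrite sumrB (bigD1_seq j _ ut (F := fun k => if k == j then z else 0)) //=.
  rewrite eqxx [X in _ - (_ + X)]big1 => [|k /negPf ->] //; rewrite addr0.
  apply/eqP; rewrite subr_eq0; apply/eqP; rewrite /t; case: ifP => js.
    by rewrite big_seq [RHS]big_seq; apply: eq_bigr => k ->.
  rewrite big_cons js add0r big_seq [RHS]big_seq.
  by apply: eq_bigr => k ->.
have /eqP := direct t d ut dL sum_d j jt.
rewrite /d eqxx subr_eq0 => /eqP; rewrite -/z => <-.
by case: ifP => // _; apply: descend_zero.
Qed.

End Descend.
End GradedModule.

(** * Even and odd polynomials *)

Section EvenOdd.
Variable K : numFieldType.
Implicit Types (p q : {poly K}).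

Definition evenp p := p \Po (- 'X) = p.

Lemma comp_sqr_opp p : (p \Po 'X^2) \Po (- 'X) = p \Po 'X^2.
Proof. by rewrite -comp_polyA comp_Xn_poly sqrrN. Qed.

Lemma evenp_sqr p : evenp (p \Po 'X^2). Proof. exact: comp_sqr_opp. Qed.

Lemma evenpM p q : evenp p -> evenp q -> evenp (p * q).
Proof. by rewrite /evenp comp_polyM => -> ->. Qed.

Lemma addpp_eq0 p : p + p = 0 -> p = 0.
Proof.
by move/eqP; rewrite -mulr2n -scaler_nat scaler_eq0 pnatr_eq0 => /eqP.
Qed.

Lemma comp_opp_even_odd p :
  p \Po (- 'X) = even_poly p \Po 'X^2 - (odd_poly p \Po 'X^2) * 'X.
Proof.
rewrite -{1}[p]poly_even_odd comp_polyD comp_polyM !comp_sqr_opp comp_polyX.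
by rewrite mulrN.
Qed.

Lemma evenpP p : evenp p -> exists q, p = q \Po 'X^2.
Proof.
move=> ep; exists (even_poly p); rewrite -{1}[p]poly_even_odd.
have : (odd_poly p \Po 'X^2) * 'X + (odd_poly p \Po 'X^2) * 'X = 0.
  move: ep; rewrite /evenp comp_opp_even_odd -{3}[p]poly_even_odd => /addrI.
  by move/eqP; rewrite -subr_eq0 -opprD oppr_eq0 => /eqP.
by move/addpp_eq0 => ->; rewrite addr0.
Qed.

Lemma oddpP p : p \Po (- 'X) = - p -> exists2 q, evenp q & p = 'X * q.
Proof.
move=> op; exists (odd_poly p \Po 'X^2); first exact: evenp_sqr.
rewrite -{1}[p]poly_even_odd mulrC.
have : (even_poly p \Po 'X^2) + (even_poly p \Po 'X^2) = 0.
  move: op; rewrite comp_opp_even_odd -{3}[p]poly_even_odd opprD => /addIr /eqP.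
  by rewrite -subr_eq0 opprK => /eqP.
by move/addpp_eq0 => ->; rewrite add0r.
Qed.

Lemma even_oddW p : exists q r, p = (q \Po 'X^2) + 'X * (r \Po 'X^2).
Proof.
by exists (even_poly p), (odd_poly p); rewrite -{1}[p]poly_even_odd mulrC.
Qed.

Lemma pairing_odd (a : nat -> K) p :
  (forall n, odd n -> a n = 0) -> pairing a ('X * (p \Po 'X^2)) = 0.
Proof.
move=> a0; rewrite /pairing big1 // => i _.
have [/a0 ->|ei] := boolP (odd i); first by rewrite mulr0.
rewrite coefXM coef_comp_poly_Xn //; case: eqVneq => [|i0]; first by rewrite mul0r.
by case: ifP => [|_]; [lia | rewrite mul0r].
Qed.

End EvenOdd.

(** * Commutators of operators of degrees 1 and -1 *)

Section Theta.
Variables (K : numFieldType) (e : sign).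
Implicit Types (b f g h : {poly K}).

Definition beta : K := (del e - 1)%:~R / 2%:R.

(* The commutator of two operators of degrees 1 and -1, see [bracket_theta]. *)
Definition theta b : Dhat K := (tD 0 (pshift beta b - pshift (beta + 1) b), b.[beta]).

(** The shifts in the bracket align the arguments of [h] and [g], and the cocycle reduces to its
    single term j = -1, which is h(beta) g(beta). *)
Lemma bracket_theta g h (c d : K) :
  bracket ((tD 1 (pshift (beta + 1) h), c) : Dhat K)
          ((tD (-1) (pshift beta g), d) : Dhat K) = theta (h * g).
Proof.
rewrite bracketE; congr pair.
  rewrite /Dbr1 !pshift_pshift !pshiftM addrN; congr tD.
  by congr (pshift _ _ * _ - _ * pshift _ _); ring.
rewrite /Psi1 addrN eqxx /= /psi_pos big_ord1 !horner_pshift hornerM.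
by rewrite (_ : (@ord0 0)%:R = 0 :> K) // !add0r [- 1 + _]addrC addrK.
Qed.

Lemma refl0E : refl e 0 = - 'X - (beta + beta + 1)%:P :> {poly K}.
Proof. by rewrite /refl /beta half_plus_half add0r intrB subrK. Qed.

(** The reflection for degree 0 sends w + beta to -(w + beta + 1). For even [b] it therefore swaps
    the two terms of [theta e b], in agreement with [psign e 0] = -1. *)
Lemma theta_deg b : evenp b -> Dpm_deg e 0 (theta b).
Proof.
move=> eb; apply/Dpm_degP; eexists; eexists; split; last by [].
  have -> : adm e 0 =
      fun f => f \Po (- 'X - (beta + beta + 1)%:P) = psign e 0 *: f.
    by rewrite -refl0E.
  have s0 : psign e 0 = -1 :> K by case: (e).
  rewrite s0 scaleN1r comp_polyB opprB /pshift -!comp_polyA.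
  congr (_ - _); rewrite -{1}eb -comp_polyA; congr (b \Po _);
    by rewrite raddfN /= comp_polyD !comp_polyX comp_polyC !polyCD; ring.
by [].
Qed.

Lemma thetaP (a : K) b c : theta (a *: b + c) = a *: theta b + theta c.
Proof.
rewrite /theta; congr pair; last by rewrite hornerD hornerZ.
rewrite !pshiftD !pshiftZ.
have := congr1 fst (tDhatP a 0 (pshift beta b - pshift (beta + 1) b)
  (pshift beta c - pshift (beta + 1) c)) => /= <-.
by congr tD; rewrite scalerBr opprD addrACA.
Qed.

Lemma thetaE b : theta b =
  b.[beta] *: ((tD 0 0, 1) : Dhat K) + tDhat 0 (pshift beta b - pshift (beta + 1) b).
Proof.
congr pair; last by rewrite /= [_ *: _]mulr1 addr0.
by rewrite /tD /= monalgU0 scaler0 add0r.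
Qed.

Lemma Dpm_shift_1 : Dpm_shift K e 1 = beta + 1.
Proof. by rewrite Dpm_shiftE /beta intrD intrB; field. Qed.

Lemma Dpm_shift_N1 : Dpm_shift K e (-1) = beta.
Proof. by rewrite Dpm_shiftE /beta addrC. Qed.

(** The factor that parity forces in degrees 1 and -1: for the plus sign the polynomials are odd,
    hence w times an even one; for the minus sign they are even already. *)
Definition oddpart : {poly K} := if e is Plus then 'X else 1.

Lemma oddpart_neq0 : oddpart != 0.
Proof. by rewrite /oddpart; case: (e); rewrite ?oner_neq0 ?polyX_eq0. Qed.

Lemma oddpart_sqr : evenp (oddpart * oddpart).
Proof.
rewrite /evenp /oddpart; case: (e); rewrite comp_polyM ?comp_polyX ?mulrNN //.
by rewrite -[1]/(1%:P) comp_polyC.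
Qed.

Lemma adm_oddpart k f : k = 1 \/ k = -1 -> adm e k f <->
  exists2 h, evenp h & f = pshift (Dpm_shift K e k) (oddpart * h).
Proof.
move=> k1; rewrite -admP; split=> [[g gP ->]|[h eh ->]].
  move: gP; rewrite /oddpart; case: (e) => /=.
    by case: k1 => -> /=; exists g => //; rewrite mul1r.
  by move=> /oddpP[h eh ->]; exists h.
exists (oddpart * h) => //; rewrite /oddpart; case: (e) => /=.
  by rewrite mul1r; case: k1 => ->.
by rewrite /odd_polyn comp_polyM comp_polyX eh mulNr.
Qed.

End Theta.

Arguments beta {K} e.
Arguments oddpart {K} e.

(** * From the labels to a recurrence for the values of [xi] on commutators *)

Section Labels.
Variables (K : numClosedFieldType) (e : sign) (xi : Dhat K -> K).
Hypothesis xi_lin : linear_form_on (Dpm_deg e 0) xi.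
Implicit Types (b g h : {poly K}).

(** Padded with 0 at odd [n], where [theta e 'X^n] need not lie in the subalgebra. *)
Definition moment n : K := if odd n then 0 else xi (theta e 'X^n).

Lemma evenp_Xn n : ~~ odd n -> evenp ('X^n : {poly K}).
Proof. by move=> en; rewrite /evenp comp_Xn_poly exprNn -signr_odd (negPf en) mul1r. Qed.

Lemma xi0 : xi 0 = 0.
Proof.
have D0 : Dpm_deg e 0 (0 : Dhat K).
  by apply/Dpm_degP; exists 0, 0; split=> //; [apply: adm0 | rewrite /tD monalgU0].
have := xi_lin 1 D0 D0.
by rewrite scaler0 addr0 mul1r => /eqP; rewrite -subr_eq0 opprD addNKr oppr_eq0 => /eqP.
Qed.

Lemma Dpm_deg0P (a : K) x y :
  Dpm_deg e 0 x -> Dpm_deg e 0 y -> Dpm_deg e 0 (a *: x + y).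
Proof.
move=> /Dpm_degP[f [c [fP _ ->]]] /Dpm_degP[g [d [gP _ ->]]].
apply/Dpm_degP; exists (a *: f + g), (a *: c + d); split=> //.
  exact: admP_lin.
by congr pair; have := congr1 fst (tDhatP a 0 f g) => /= ->.
Qed.

Lemma xi_sum (I : Type) (r : seq I) (P : pred I) (c : I -> K) (x : I -> Dhat K) :
  (forall i, P i -> Dpm_deg e 0 (x i)) ->
  xi (\sum_(i <- r | P i) c i *: x i) = \sum_(i <- r | P i) c i * xi (x i).
Proof.
move=> xP; suff [] : Dpm_deg e 0 (\sum_(i <- r | P i) c i *: x i) /\
    xi (\sum_(i <- r | P i) c i *: x i) = \sum_(i <- r | P i) c i * xi (x i) by [].
elim: r => [|i r [IH1 IH2]]; first by rewrite !big_nil xi0; split=> //;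
  apply/Dpm_degP; exists 0, 0; split=> //; [apply: adm0 | rewrite /tD monalgU0].
rewrite !big_cons; case: ifP => // Pi; split; first by apply: Dpm_deg0P => //; apply: xP.
by rewrite xi_lin ?IH2 //; apply: xP.
Qed.

Lemma pairing_moment b : evenp b -> pairing moment b = xi (theta e b).
Proof.
move=> /evenpP[r ->]; rewrite comp_polyE pairing_sum.
have -> : theta e (\sum_(i < size r) r`_i *: 'X^2 ^+ i)
    = \sum_(i < size r) r`_i *: theta e ('X^(i.*2)).
  elim/big_rec2: _ => [|i x y _ <-]; last by rewrite thetaP -exprM mul2n.
  rewrite /theta /pshift !comp_poly0 subrr horner0.
  by rewrite /tD monalgU0.
rewrite xi_sum => [|i _]; last by apply/theta_deg/evenp_Xn; rewrite odd_double.
apply: eq_bigr => i _; rewrite -exprM mul2n pairingZ pairingXn /moment.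
by rewrite odd_double.
Qed.

(** A test polynomial splits into an even and an odd part; after multiplication by the even [g], the
    odd part pairs to zero with the padded sequence. *)
Lemma annih_moment g : evenp g ->
  annih g moment <-> forall h, evenp h -> xi (theta e (g * h)) = 0.
Proof.
move=> eg; split=> [ga h eh|gh q]; first by rewrite -pairing_moment ?ga //; apply: evenpM.
have [q1 [q2 ->]] := even_oddW q; have [g' eg'] := evenpP eg.
rewrite mulrDr pairingD pairing_moment; last by apply/evenpM/evenp_sqr.
rewrite gh ?add0r; last exact: evenp_sqr.
rewrite mulrCA eg' -comp_polyM pairing_odd // => n on.
by rewrite /moment on.
Qed.

Definition central : Dhat K := (tD 0 0, 1).

Lemma labelE n :
  label e xi n = - xi (tDhat 0 (('X + ((del e)%:~R / 2%:R)%:P) ^+ n)).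
Proof.
by rewrite /label /del; case: (e); rewrite ?mul0r ?addr0 // div1r.
Qed.

Lemma adm_odd_power n : odd n ->
  adm e 0 (('X + ((del e)%:~R / 2%:R)%:P) ^+ n : {poly K}).
Proof.
move=> on; rewrite /adm -comp_Xn_poly -comp_polyA.
rewrite comp_polyD comp_polyX comp_polyC /refl add0r.
have -> : - 'X - ((del e)%:~R)%:P + ((del e)%:~R / 2%:R)%:P
    = - ('X + ((del e)%:~R / 2%:R)%:P) :> {poly K}.
  by rewrite -{1}[(del e)%:~R]half_plus_half polyCD; ring.
rewrite !comp_Xn_poly exprNn -signr_odd on expr1 mulN1r.
by rewrite (_ : psign e 0 = -1 :> K) ?scaleN1r //; case: (e).
Qed.

(** Since beta = del/2 - 1/2, both shifted powers expand binomially in D + del/2 with increments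
    -1/2 and 1/2. Their difference reproduces the coefficients of 2 sinh(x/2), with the minus sign
    contained in the labels. For even [n] only odd powers of D + del/2 survive. *)
Lemma label_quotient n : n`!%:R * fps_mul (Delta e xi) (two_sinh_half K) n
  = if odd n then 0
    else xi (tDhat 0 (pshift (beta e) 'X^n - pshift (beta e + 1) 'X^n)).
Proof.
set D := 'X + ((del e)%:~R / 2%:R)%:P : {poly K}.
(* These are m! times the coefficients of 2 sinh(x/2). *)
pose c m : K := 2%:R^-1 ^+ m - (- 2%:R^-1) ^+ m.
have c_even m : ~~ odd m -> c m = 0.
  by move=> em; rewrite /c exprNn -signr_odd (negPf em) mul1r subrr.
have -> : n`!%:R * fps_mul (Delta e xi) (two_sinh_half K) n =
    \sum_(i < n.+1 | odd i) (- ('C(n, i)%:R * c (n - i)%N)) * xi (tDhat 0 (D ^+ i)).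
  rewrite /fps_mul mulr_sumr [RHS]big_mkcond; apply: eq_bigr => i _.
  rewrite /Delta; case: ifP => oi; last by rewrite mul0r mulr0.
  rewrite labelE -/D /two_sinh_half /fps_sinh /fps_exp /c.
  have le_in : (i <= n)%N by rewrite -ltnS.
  have := bin_fact le_in; move: (fact_neq0 K (n - i)) (fact_neq0 K i) => h1 h2.
  by move=> <-; rewrite !natrM; field; rewrite h1 h2.
case: ifP => on.
  rewrite big1 // => i oi; rewrite c_even ?mulr0 ?oppr0 ?mul0r //.
  by rewrite oddB ?on ?oi // -ltnS.
rewrite -xi_sum => [|i oi]; last by apply/Dpm_deg_tDhat/adm_odd_power.
congr xi; rewrite -[LHS]addr0.
have tDsum (r : seq 'I_n.+1) (a : 'I_n.+1 -> K) (f : 'I_n.+1 -> {poly K}) (P : pred 'I_n.+1) :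
    \sum_(i <- r | P i) a i *: tDhat 0 (f i) = tDhat 0 (\sum_(i <- r | P i) a i *: f i).
  elim/big_rec2: _ => [|i x y _ ->]; last by rewrite tDhatP.
  by rewrite /tDhat /tD monalgU0.
rewrite addr0 tDsum; congr tDhat.
have -> : pshift (beta e) 'X^n = (- 2%:R^-1%:P + D) ^+ n.
  rewrite /pshift comp_Xn_poly; congr (_ ^+ n); rewrite /D /beta addrCA; congr ('X + _).
  by rewrite -polyCN -polyCD; congr (_%:P); rewrite intrB; field.
have -> : pshift (beta e + 1) 'X^n = (2%:R^-1%:P + D) ^+ n.
  rewrite /pshift comp_Xn_poly; congr (_ ^+ n); rewrite /D /beta addrCA; congr ('X + _).
  by rewrite -polyCD; congr (_%:P); rewrite intrB; field.
rewrite !exprDn -sumrB [LHS]big_mkcond; apply: eq_bigr => i _.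
rewrite -polyCN -!polyC_exp -mulrnBl -mulrBl -polyCB.
have -> : (- 2%:R^-1) ^+ (n - i) - 2%:R^-1 ^+ (n - i) = - c (n - i)%N by rewrite opprB.
case: ifP => oi; last by rewrite c_even ?oppr0 ?mul0r ?mul0rn // oddB ?on ?oi // -ltnS.
by rewrite mul_polyC -scaler_nat scalerA mulrN.
Qed.

(** The second summand is n! times the coefficient of xi(C) cosh(beta x); it comes from the central
    term of [theta]. *)
Lemma momentE n : moment n = n`!%:R * fps_mul (Delta e xi) (two_sinh_half K) n
  + xi central / 2%:R * (beta e ^+ n + (- beta e) ^+ n).
Proof.
rewrite label_quotient /moment exprNn -signr_odd; case: ifP => on.
  by rewrite mulN1r subrr mulr0 addr0.
have en : evenp ('X^n : {poly K}) by apply: evenp_Xn; rewrite on.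
have /Dpm_degP[f [c [fP _]]] := theta_deg e en.
move=> /(congr1 (fun x : Dhat K => x.1@_0)); rewrite /= /tD !mcoeffUU => ef.
rewrite thetaE xi_lin -/central; last first.
- by apply: Dpm_deg_tDhat; rewrite ef.
- by apply/Dpm_degP; exists 0, 1; split=> //; apply: adm0.
by rewrite hornerXn mul1r addrC; congr (_ + _); field.
Qed.

Lemma quotient_quasipolynomial :
  (exists F : fps K, [/\ quasipolynomial F, fps_even F, F 0%N = 0 &
     fps_is_quotient (Delta e xi) F (two_sinh_half K)]) <->
  exists2 g, g != 0 & evenp g /\ annih g moment.
Proof.
have qb : quasipolynomial (egf (fun n =>
    xi central / 2%:R * (beta e ^+ n + (- beta e) ^+ n))).
  have q1 := quasipolynomial_binexp 0 (beta e : K).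
  have q2 := quasipolynomial_binexp 0 (- beta e : K).
  apply: (eq_quasipolynomial _ (quasipolynomialZ (xi central / 2%:R)
    (quasipolynomialD q1 q2))) => n.
  by rewrite /egf /binexp !bin0 !subn0 !mul1r -mulrDl mulrA.
set G := fps_mul (Delta e xi) (two_sinh_half K).
have G_egf n : G n = egf (fun m => m`!%:R * G m) n.
  by rewrite /egf mulrC mulKf ?fact_neq0.
have -> : (exists F : fps K, [/\ quasipolynomial F, fps_even F, F 0%N = 0 &
    fps_is_quotient (Delta e xi) F (two_sinh_half K)]) <-> quasipolynomial G.
  split=> [[F [qF _ _ FP]]|qG]; first by apply: (eq_quasipolynomial _ qF) => n; rewrite -FP.
  (* Being a product of two odd series, [G] is even and vanishes at 0. *)
  exists G; split=> // [n|].
    rewrite -signr_odd; case: (boolP (odd n)) => on; last by rewrite mul1r.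
    apply: (mulfI (fact_neq0 K n)); rewrite mulrCA label_quotient on mulr0.
    by [].
  by rewrite /G /fps_mul big_ord1 /Delta mul0r.
split=> [qG|[g g0 [_ ga]]].
  have [p p0 pa] : exists2 p, p != 0 & annih p moment.
    apply: annih_quasipolynomial.
    apply: (eq_quasipolynomial _ (quasipolynomialD qG qb)) => n.
    by rewrite /egf momentE mulrDl; congr (_ + _); rewrite [LHS]G_egf.
  (* The product p(w) p(-w) is even and still annihilates. *)
  exists (p * (p \Po (- 'X))); last split.
  - rewrite mulf_neq0 //; apply: contra_neq p0 => p0.
    have : (p \Po (- 'X)) \Po (- 'X) = 0 by rewrite p0 comp_poly0.
    by rewrite -comp_polyA raddfN /= comp_polyX opprK comp_polyXr.
  - by rewrite /evenp comp_polyM -comp_polyA raddfN /= comp_polyX opprK comp_polyXr mulrC.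
  - exact: annih_mulr.
have qm := quasipolynomial_annih g0 ga.
apply: (eq_quasipolynomial _ (quasipolynomialD qm (quasipolynomialZ (-1) qb))) => n.
by rewrite [RHS]G_egf /egf momentE -/G mulrDl mulN1r addrK.
Qed.

End Labels.

(** * Finite spanning sets *)

Section LinearSpan.
Variables (K : fieldType) (V : lmodType K).
Implicit Types (S T U P : V -> Prop) (u w : V).

Inductive lin_span S : V -> Prop :=
| lin_span_zero : lin_span S 0
| lin_span_add (a : K) x u : S x -> lin_span S u -> lin_span S (a *: x + u).

Lemma lin_span_base S x : S x -> lin_span S x.
Proof. by move=> Sx; rewrite -[x]scale1r -[_ *: x]addr0; apply: lin_span_add (lin_span_zero S). Qed.

Lemma lin_spanP S (a : K) u w : lin_span S u -> lin_span S w -> lin_span S (a *: u + w).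
Proof.
move=> Su Sw; elim: Su => [|b x y Sx _ IH]; first by rewrite scaler0 add0r.
by rewrite scalerDr scalerA -addrA; apply: lin_span_add.
Qed.

Lemma lin_spanD S u w : lin_span S u -> lin_span S w -> lin_span S (u + w).
Proof. by move=> Su Sw; rewrite -[u]scale1r; apply: lin_spanP. Qed.

Lemma lin_span_trans S T u : (forall x, S x -> lin_span T x) -> lin_span S u -> lin_span T u.
Proof.
by move=> ST; elim=> [|a x w Sx _ IH]; [apply: lin_span_zero | apply: lin_spanP => //; apply: ST].
Qed.

Lemma lin_span_sum S (I : Type) (r : seq I) (a : I -> K) (x : I -> V) :
  (forall i, lin_span S (x i)) -> lin_span S (\sum_(i <- r) a i *: x i).
Proof.
move=> Sx; elim/big_ind: _ => [|u w|i _]; [exact: lin_span_zero | exact: lin_spanD |].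
by rewrite -[_ *: _]addr0; apply: lin_spanP => //; apply: lin_span_zero.
Qed.

(** The set [P] may be any set of vectors, so that a component can be treated as the span of a union
    of simpler sets; the spanning list is still taken in [U]. *)
Definition fin_spanned U P :=
  exists2 s : seq V, (forall x, x \in s -> U x) &
    forall u, P u -> lin_span (fun x => x \in s) u.

Lemma fin_spanned_zero U P : (forall u, P u -> u = 0) -> fin_spanned U P.
Proof. by move=> P0; exists [::] => // u /P0 ->; apply: lin_span_zero. Qed.

Lemma fin_spannedU U P P' : fin_spanned U P -> fin_spanned U P' ->
  fin_spanned U (fun u => P u \/ P' u).
Proof.
move=> [s sU sP] [t tU tP]; exists (s ++ t) => [x|u].
  by rewrite mem_cat => /orP[/sU|/tU].
by case=> [/sP|/tP]; apply: lin_span_trans => x xs; apply: lin_span_base;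
    by rewrite mem_cat xs ?orbT.
Qed.

Lemma fin_spanned_bigU U n (P : nat -> V -> Prop) :
  (forall i, (i < n)%N -> fin_spanned U (P i)) ->
  fin_spanned U (fun u => exists2 i, (i < n)%N & P i u).
Proof.
elim: n => [|n IHn] nP; first by apply: fin_spanned_zero => u [].
have [s sU sP] := fin_spannedU (IHn (fun i lt_in => nP i (ltnW lt_in))) (nP n (leqnn _)).
exists s => // u [m]; rewrite ltnS leq_eqVlt => /predU1P[->|lt_mn] Pu; apply: sP.
  by right.
by left; exists m.
Qed.

Lemma fin_spanned_sub U P P' :
  (forall u, P' u -> lin_span P u) -> fin_spanned U P -> fin_spanned U P'.
Proof.
move=> P'P [s sU sP]; exists s => // u /P'P; apply: lin_span_trans => x; exact: sP.
Qed.

Lemma finite_dimP U : fin_spanned U U <-> finite_dim U.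
Proof.
split=> [[s sU sP]|[n [b [bU bP]]]].
  exists (size s), (fun i => s`_i); split=> [i|u /sP]; first by apply/sU/mem_nth.
  elim=> [|a x w xs _ [c ->]].
    by exists (fun=> 0); rewrite big1 // => i _; rewrite scale0r.
  have lt_x : (index x s < size s)%N by rewrite index_mem.
  exists (fun i => c i + (if i == Ordinal lt_x then a else 0)).
  under [RHS]eq_bigr => i _ do rewrite scalerDl.
  rewrite big_split /= addrC; congr (_ + _).
  rewrite (bigD1 (Ordinal lt_x)) //= eqxx nth_index // big1 ?addr0 //.
  by move=> i /negPf ->; rewrite scale0r.
exists [seq b i | i : 'I_n] => [x /mapP[i _ ->] //|u /bP[c ->]].
by apply: lin_span_sum => i; apply/lin_span_base/map_f; rewrite mem_enum.
Qed.

End LinearSpan.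

(** * Divisibility and projection for polynomials with a reflection symmetry *)

Section Symmetric.
Variables (K : numFieldType) (e : sign).
Implicit Types (f g p q r : {poly K}) (k : int).

(** The coordinate w + (k + del)/2, which the reflection for degree [k] negates. *)
Definition centre k : {poly K} := 'X + (Dpm_shift K e k)%:P.

Lemma centre_refl k : centre k \Po refl e k = - centre k.
Proof.
by rewrite /centre -{1}['X](pshift0) /pshift polyC0 addr0 comp_polyXr
  comp_polyD comp_polyX comp_polyC -reflE /pshift raddfN /= comp_polyX.
Qed.

Lemma adm_centre_sqr k f : adm e k f -> adm e k (f * centre k ^+ 2).
Proof.
move=> fP; rewrite /adm expr2 !comp_polyM !centre_refl fP.
by rewrite mulrNN scalerAl.
Qed.

Lemma adm_centre_comp k f p : adm e k f -> adm e k (f * (p \Po (centre k ^+ 2))).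
Proof.
move=> fP; rewrite /adm comp_polyM -comp_polyA expr2 comp_polyM !centre_refl fP.
by rewrite mulrNN -expr2 scalerAl.
Qed.

Lemma symmetric_centre k r : r \Po refl e k = r -> exists p, r = p \Po (centre k ^+ 2).
Proof.
rewrite -[r](pshiftNK (Dpm_shift K e k)) -{2}[pshift _ _]scale1r.
move=> /reflP; rewrite scale1r => /evenpP[p pE].
exists p; rewrite pE /pshift -comp_polyA comp_Xn_poly.
by [].
Qed.

Lemma adm_cofactor k q r : q != 0 -> adm e k q -> adm e k (q * r) -> r \Po refl e k = r.
Proof.
move=> q0 qP; rewrite /adm comp_polyM qP -!scalerAl => /scalerI.
have s0 : psign e k != 0 :> K.
  by apply/eqP => s0; have := psign_sqr K e k; rewrite s0 mul0r => /eqP; rewrite eq_sym oner_eq0.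
by move=> /(_ s0) /(mulfI q0).
Qed.

(** The projection onto admissible polynomials, by signed averaging over the reflection. *)
Definition adm_proj k f : {poly K} := 2%:R^-1 *: (f + psign e k *: (f \Po refl e k)).

Lemma adm_adm_proj k f : adm e k (adm_proj k f).
Proof.
rewrite /adm /adm_proj comp_polyZ comp_polyD comp_polyZ -comp_polyA refl_refl.
rewrite comp_polyXr [RHS]scalerA [_ * 2%:R^-1]mulrC -[RHS]scalerA; congr (_ *: _).
by rewrite [RHS]scalerDr scalerA psign_sqr scale1r addrC.
Qed.

Lemma adm_proj_id k f : adm e k f -> adm_proj k f = f.
Proof.
move=> fP; rewrite /adm_proj fP scalerA psign_sqr scale1r.
by rewrite -mulr2n -scaler_nat scalerA mulVf ?scale1r ?pnatr_eq0.
Qed.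

Lemma adm_projP k (a : K) f g : adm_proj k (a *: f + g) = a *: adm_proj k f + adm_proj k g.
Proof.
rewrite /adm_proj comp_polyD comp_polyZ -!mul_polyC; ring.
Qed.

(** The reflection swaps the factors [q] and [q \Po refl e k], so [q] divides both [f] and its
    reflection. *)
Lemma dvdp_adm_proj k q f : q * (q \Po refl e k) %| f -> q %| adm_proj k f.
Proof.
move=> /dvdpP[r ->]; rewrite /adm_proj !comp_polyM -comp_polyA refl_refl comp_polyXr.
rewrite dvdpZr ?invr_eq0 ?pnatr_eq0 // dvdp_add //.
  by rewrite dvdp_mull // dvdp_mulr.
by rewrite scalerAl dvdp_mull // dvdp_mull.
Qed.

Lemma refl_eq0 k q : (q \Po refl e k == 0) = (q == 0).
Proof.
apply/eqP/eqP => [q0|->]; last by rewrite comp_poly0.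
by rewrite -[q]comp_polyXr -(refl_refl K e k) comp_polyA q0 comp_poly0.
Qed.

End Symmetric.

(** * Generation by the highest weight vector, and singular vectors *)

Section HighestWeight.
Variables (K : numClosedFieldType) (e : sign) (xi : Dhat K -> K).
Hypothesis xi_lin : linear_form_on (Dpm_deg e 0) xi.
Variables (V : lmodType K) (act : Dhat K -> V -> V) (L : int -> V -> Prop) (v : V).
Hypothesis LV : irreducible_hw_module e xi act L v.
Implicit Types (f g h q : {poly K}) (i j k : int) (x y : Dhat K) (u w : V).

Lemma hw_graded : graded_module e act L. Proof. by case: LV. Qed.
Let gL := hw_graded.

Lemma hw_neq0 : v != 0. Proof. by case: LV => _ _ [+ _ _] _ _. Qed.

Lemma hw_L0 : L 0 v. Proof. by case: LV => _ _ [_ + _] _ _. Qed.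

Lemma hw_act0 x : Dpm_deg e 0 x -> act x v = xi x *: v.
Proof. by case: LV => _ _ _ + _; apply. Qed.

Lemma hw_pos i x : (0 < i)%R -> Dpm_deg e i x -> act x v = 0.
Proof. by case: LV => _ _ _ _; apply. Qed.

Definition hw_line u := exists a : K, u = a *: v.

Lemma hw_line_L0 w : hw_line w -> L 0 w.
Proof.
by case=> a ->; rewrite -[a *: v]addr0; apply: (LP gL) (L0 gL 0); apply: hw_L0.
Qed.

(** The vectors obtained from [v] by operators of negative degree already span a submodule
    containing [v], hence the whole module. *)
Lemma descend_hw j u : L j u -> descend e act 0 hw_line j u.
Proof.
apply: (descend_span_homog gL hw_line_L0).
have [_ _ [_ _ gen] _ _] := LV; apply: gen.
  apply: (descend_submodule gL) => [x w xP [a ->]|k x w k0 xP [a ->]].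
    rewrite (actZr gL) ?hw_act0 //; last exact: Dpm_deg_Dpm xP.
    by exists (a * xi x); rewrite scalerA.
  rewrite (actZr gL) ?(hw_pos k0 xP) ?scaler0 //; exact: Dpm_deg_Dpm xP.
rewrite -[v]addr0; apply: descend_spanD (descend_span0 _ _ _ _).
by apply: descend_base; exists 1; rewrite scale1r.
Qed.

(** Operators of degree above 1 send L_1 to negative degrees, so such a [u] is killed by every
    positive degree. The submodule it generates lives in degrees at least 1 and misses [v];
    irreducibility makes it zero. *)
Lemma singular_eq0 u : L 1 u -> (forall x, Dpm_deg e 1 x -> act x u = 0) -> u = 0.
Proof.
pose B w := L 1 w /\ forall x, Dpm_deg e 1 x -> act x w = 0.
move=> Lu su; have Bu : B u by [].
have BL w : B w -> L 1 w by case.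
have B_pos i x w : (0 < i)%R -> Dpm_deg e i x -> B w -> act x w = 0.
  move=> i0 xP [Lw sw]; have [i1|i1] := eqVneq i 1; first by apply: sw; rewrite -i1.
  by apply: (L_neg gL) (L_act gL xP Lw); lia.
have B_zero x w : Dpm_deg e 0 x -> B w -> B (act x w).
  move=> xP [Lw sw]; split=> [|y yP]; first by have := L_act gL xP Lw; rewrite subr0.
  have := act_bracket gL w (Dpm_deg_Dpm yP) (Dpm_deg_Dpm xP).
  rewrite sw; last by have := Dpm_deg_bracket yP xP; rewrite addr0.
  rewrite (sw y) // (act0r gL) ?subr0 //; exact: Dpm_deg_Dpm xP.
have [_ [_ irr] _ _ _] := LV.
case: (irr _ (descend_submodule gL 1 B_zero B_pos)) => [U0|UV].
  apply: U0; rewrite -[u]addr0; apply: descend_spanD (descend_span0 _ _ _ _).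
  exact: descend_base.
have := descend_span_homog gL BL (UV v) hw_L0.
case/(descend_sub gL BL) => _ v0.
by have := hw_neq0; rewrite v0 ?eqxx.
Qed.

(** * Operators that kill the highest weight vector *)

Definition vanishing k q := act (tDhat k q) v = 0.

Lemma act_tDhatP (a : K) k f g u : adm e k f -> adm e k g ->
  act (tDhat k (a *: f + g)) u = a *: act (tDhat k f) u + act (tDhat k g) u.
Proof.
by move=> fP gP; rewrite tDhatP (actP gL) //; apply: Dpm_deg_Dpm (Dpm_deg_tDhat _).
Qed.

Lemma act_tDhat0 k u : act (tDhat k 0) u = 0.
Proof. by rewrite /tDhat /tD monalgU0; apply: (act0l gL). Qed.

Lemma act_tDhatZ (a : K) k f u : adm e k f ->
  act (tDhat k (a *: f)) u = a *: act (tDhat k f) u.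
Proof.
move=> fP; rewrite -[a *: f]addr0 act_tDhatP ?act_tDhat0 ?addr0 //; exact: adm0.
Qed.

Lemma act_tDhat_sum k u (I : Type) (r : seq I) (a : I -> K) (F : I -> {poly K}) :
  (forall m, adm e k (F m)) ->
  act (tDhat k (\sum_(m <- r) a m *: F m)) u = \sum_(m <- r) a m *: act (tDhat k (F m)) u.
Proof.
move=> FP; elim: r => [|m r IHr]; first by rewrite !big_nil act_tDhat0.
rewrite !big_cons act_tDhatP ?IHr //; elim/big_ind: _ => [|f g fP gP|m' _].
- exact: adm0.
- by rewrite -[f]scale1r; apply: admP_lin.
- by rewrite -[_ *: _]addr0; apply: admP_lin => //; apply: adm0.
Qed.

(* The cube of the degree 0 operator D + (del e)/2 commutes with t^k q(D) to a
   combination of t^k q(D) and t^k q(D) u^2, where u is [centre e k] at D. *)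
Lemma vanishing_centre_sqr k q : k != 0 -> adm e k q -> vanishing k q ->
  vanishing k (q * centre K e k ^+ 2).
Proof.
move=> k0 qP qv; rewrite /vanishing; set kK : K := k%:~R.
pose h : {poly K} := ('X + ((del e)%:~R / 2%:R)%:P) ^+ 3.
have hP : adm e 0 h by exact: adm_odd_power.
have hD := Dpm_deg_tDhat hP; have qD := Dpm_deg_tDhat qP.
have := act_bracket gL v (Dpm_deg_Dpm hD) (Dpm_deg_Dpm qD).
rewrite qv (act0r gL); last exact: Dpm_deg_Dpm hD.
rewrite (hw_act0 hD) (actZr gL); last exact: Dpm_deg_Dpm qD.
rewrite qv scaler0 subrr bracket_neq0 ?add0r //.
have -> : pshift k%:~R h * q - h * pshift 0%:~R q
    = (3%:R * kK) *: (q * centre K e k ^+ 2) + (kK ^+ 3 / 4%:R) *: q.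
  rewrite pshift0 /h /centre Dpm_shiftE /pshift rmorphXn /=.
  rewrite comp_polyD comp_polyX comp_polyC.
  have -> : ((del e)%:~R / 2%:R : K) = (k + del e)%:~R / 2%:R - kK / 2%:R.
    by rewrite intrD /kK; field.
  set c := _%:~R / 2%:R; rewrite -/kK.
  (* Writing k as 2d clears the denominators before [ring]. *)
  have [d ->] : exists d, kK = 2%:R * d by exists (kK / 2%:R); field.
  have -> : 2%:R * d / 2%:R = d by field.
  have -> : (2%:R * d) ^+ 3 / 4%:R = 2%:R * d ^+ 3 by field.
  by rewrite -!mul_polyC; ring.
rewrite act_tDhatP; last first.
- by rewrite -[_ *: _]addr0; apply: admP_lin => //; apply: adm0.
- exact: adm_centre_sqr.
rewrite act_tDhatZ // qv scaler0 addr0 => /eqP; rewrite scaler_eq0 mulf_eq0.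
by rewrite pnatr_eq0 /= intr_eq0 (negPf k0) => /eqP.
Qed.

(** The cofactor f/q is invariant under the reflection, hence a polynomial in the square of
    [centre K e k], and multiplication by this square preserves vanishing. *)
Lemma vanishing_dvd k q f : k != 0 -> q != 0 -> adm e k q -> vanishing k q ->
  adm e k f -> q %| f -> vanishing k f.
Proof.
move=> k0 q0 qP qv fP /dvdpP[r fE]; rewrite mulrC in fE; rewrite fE in fP *.
have [p ->] := symmetric_centre (adm_cofactor q0 qP fP).
elim/poly_ind: p q qP qv {f r q0 fP fE} => [|p a IHp] q qP qv.
  by rewrite comp_poly0 mulr0; apply: act_tDhat0.
have q2P := adm_centre_sqr qP.
have -> : q * ((p * 'X + a%:P) \Po (centre K e k ^+ 2)) =
    a *: q + q * centre K e k ^+ 2 * (p \Po (centre K e k ^+ 2)).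
  by rewrite comp_polyD comp_polyM comp_polyX comp_polyC -mul_polyC; ring.
rewrite /vanishing act_tDhatP ?qv ?scaler0 ?add0r //; last exact: adm_centre_comp.
by apply: IHp => //; apply: vanishing_centre_sqr.
Qed.

(** The commutator of two operators killing [v] kills [v], so only its non-vanishing is at stake. If
    it is zero for [q1], then [q1] is multiplied by the square of [centre K e (-1)]. *)
Lemma vanishing_step k q1 q : (0 < k)%R ->
  q1 != 0 -> adm e (-1) q1 -> vanishing (-1) q1 ->
  q != 0 -> adm e (- k) q -> vanishing (- k) q ->
  exists q', [/\ q' != 0, adm e (- (k + 1)) q' & vanishing (- (k + 1)) q'].
Proof.
move=> k0 q10 q1P q1v q0 qP qv; have deg : -1 + - k = - (k + 1) by lia.
pose F f := pshift (- k)%:~R f * q - f * pshift (-1)%:~R q.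
have Fgood f : adm e (-1) f -> vanishing (-1) f -> F f != 0 ->
    exists q', [/\ q' != 0, adm e (- (k + 1)) q' & vanishing (- (k + 1)) q'].
  move=> fP fv Ff0; exists (F f); rewrite -deg; split=> //; first exact: adm_bracket.
  have fD := Dpm_deg_Dpm (Dpm_deg_tDhat fP); have qD := Dpm_deg_Dpm (Dpm_deg_tDhat qP).
  rewrite /vanishing /F -(@bracket_neq0 K _ f 0 _ q 0); last by lia.
  by rewrite (act_bracket gL) // qv fv !(act0r gL) // subrr.
have [F0|] := eqVneq (F q1) 0; last exact: Fgood.
apply: (Fgood (q1 * centre K e (-1) ^+ 2)).
- exact: adm_centre_sqr.
- exact: vanishing_centre_sqr.
set z := centre K e (-1).
have /eqP := F0; rewrite subr_eq0 => /eqP E.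
(* The relation [F q1 = 0] lets both terms share the factor q1(w) q(w - 1). *)
have -> : F (q1 * z ^+ 2) =
    q1 * pshift (-1)%:~R q * (pshift (- k)%:~R (z ^+ 2) - z ^+ 2).
  by rewrite mulrBr -{1}E /F pshiftM; ring.
apply/eqP => /eqP; rewrite mulf_eq0.
rewrite mulf_eq0 (negPf q10) pshift_eq0 (negPf q0) /= subr_eq0 => /eqP.
(* At the root of [z] the supposed equality becomes k^2 = 0. *)
move/(congr1 (horner^~ (- Dpm_shift K e (-1)))).
rewrite horner_pshift !horner_exp /z /centre !hornerE addrAC addNr add0r.
by move/eqP; rewrite expr0n /= sqrf_eq0 intr_eq0; lia.
Qed.

Lemma exists_vanishing q1 k : (0 < k)%R ->
  q1 != 0 -> adm e (-1) q1 -> vanishing (-1) q1 ->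
  exists q, [/\ q != 0, adm e (- k) q & vanishing (- k) q].
Proof.
move=> k0 q10 q1P q1v; have -> : k = (`|k|.-1)%:Z + 1 by lia.
elim: `|k|.-1 => [|m [q [q0 qP qv]]]; first by exists q1.
have -> : m.+1%:Z + 1 = (m%:Z + 1) + 1 by lia.
by apply: vanishing_step q10 q1P q1v q0 qP qv; lia.
Qed.

(** * Operators that kill a graded component, and finite-dimensionality *)

Definition kills j k q := forall f u,
  adm e (- k) f -> q %| f -> L j u -> act (tDhat (- k) f) u = 0.

Lemma kills_below q1 (m : nat) k : (0 < k)%R ->
  q1 != 0 -> adm e (-1) q1 -> vanishing (-1) q1 ->
  exists2 q, q != 0 & forall j, (j < m)%R -> kills j k q.
Proof.
move=> k0 q10 q1P q1v; elim: m k k0 => [|m IHm] k k0.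
  exists 1; rewrite ?oner_neq0 // => j j0 f u fP _ Lu.
  by rewrite (L_neg gL j0 Lu) (act0r gL) //; apply: Dpm_deg_Dpm (Dpm_deg_tDhat fP).
(* The commutator with an operator t^-i h(D) has polynomial f(D-i) h(D) - f(D) h(D-k). It is
   divisible by [q] once [f] is divisible by [q] and by its shift by i, and [Q] collects both. Since
   the vector acted on lies in degree at least 0 and its image in degree at most m, only 0 < i <= m
   occurs. *)
have [Q Q0 QP] : exists2 Q : {poly K}, Q != 0 & forall i : nat, (0 < i <= m)%N ->
    exists q, [/\ q %| Q, pshift i%:R q %| Q & forall j, (j < m)%R -> kills j (k + i) q].
  elim: {1}m => [|n [Q Q0 QP]]; first by exists 1; rewrite ?oner_neq0 // => i; lia.
  have [|q q0 qP] := IHm (k + n.+1); first by lia.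
  exists (Q * (q * pshift n.+1%:R q)) => [|i].
    by rewrite !mulf_neq0 ?pshift_eq0.
  move=> /andP[i0]; rewrite leq_eqVlt => /orP[/eqP ->|lt_in].
    by exists q; split; [rewrite dvdp_mull // dvdp_mulr|rewrite dvdp_mull // dvdp_mull|].
  have [|r [rQ1 rQ2 rP]] := QP i; first by rewrite i0.
  by exists r; split; [rewrite dvdp_mulr|rewrite dvdp_mulr|].
have [qk qk0 qkP] := IHm k k0.
have [qv [qv0 qvP qvv]] := exists_vanishing k0 q10 q1P q1v.
exists (qk * qv * Q); first by rewrite !mulf_neq0.
move=> j lt_jm f u fP qf /descend_hw Wu.
have qkf : qk %| f by apply: dvdp_trans qf; rewrite -mulrA dvdp_mulr.
have qvf : qv %| f by apply: dvdp_trans qf; rewrite mulrAC dvdp_mull.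
have Qf : Q %| f by apply: dvdp_trans qf; rewrite dvdp_mull.
have fD := Dpm_deg_Dpm (Dpm_deg_tDhat fP).
elim: Wu lt_jm => {j u} [u [a ->]|j|j a u w _ IHu _ IHw|i j y u i0 yP Wu _] lt_jm.
- rewrite (actZr gL) // (vanishing_dvd _ qv0 qvP qvv) ?scaler0 //; lia.
- exact: (act0r gL).
- by rewrite (act_linr gL) // IHu // IHw // scaler0 addr0.
have [Lu _] := descend_sub gL hw_line_L0 Wu.
have [j0|j0] := ltrP j 0.
  by rewrite (L_neg gL j0 Lu) !(act0r gL) //; apply: Dpm_deg_Dpm yP.
have yD := Dpm_deg_Dpm yP; have := act_bracket gL u fD yD.
rewrite (qkP j _ f u) //; last by lia.
rewrite (act0r gL) // subr0 => <-.
have /Dpm_degP[h [c [hP _ yE]]] := yP.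
rewrite yE bracket_neq0; last by lia.
have [|q [qQ1 qQ2 qP]] := QP `|i|%N; first by lia.
have iE : i = `|i|%N :> int by lia.
have deg : - k + - i = - (k + `|i|%N) by lia.
rewrite deg; apply: qP Lu; first by lia.
  by rewrite -deg; apply: adm_bracket.
rewrite dvdp_sub //; last by rewrite dvdp_mulr // (dvdp_trans qQ1).
rewrite dvdp_mulr // -[q]pshift0 -(addNr (`|i|%N%:R)) -pshift_pshift.
rewrite iE mulrNz; apply: dvdp_pshift.
exact: dvdp_trans Qf.
Qed.

Definition generators j w := (j = 0 /\ w = v) \/
  exists2 i, (0 < i <= j)%R & exists y u, [/\ Dpm_deg e (- i) y, L (j - i) u & w = act y u].

Lemma L_generators j u : L j u -> lin_span (generators j) u.
Proof.
move=> /descend_hw; elim=> {j u} [u [a ->]|j|j a u w _ IHu _ IHw|i j y u i0 yP Wu _].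
- rewrite -[_ *: _]addr0; apply: lin_span_add (lin_span_zero _).
  by left.
- exact: lin_span_zero.
- exact: lin_spanP.
have [Lu _] := descend_sub gL hw_line_L0 Wu.
have [j0|j0] := ltrP j 0.
  rewrite (L_neg gL j0 Lu) (act0r gL); first exact: lin_span_zero.
  exact: Dpm_deg_Dpm yP.
apply: lin_span_base; right; exists i; first by lia.
by exists y, u; split=> //; rewrite addrK.
Qed.

(** Induction on the degree: L_j is spanned by images of lower components. For each degree of
    operators, those whose polynomial is a multiple of a fixed one act by zero, so finitely many
    operators suffice. *)
Lemma quasifinite_of_vanishing q1 :
  q1 != 0 -> adm e (-1) q1 -> vanishing (-1) q1 -> quasifinite L.
Proof.
move=> q10 q1P q1v.
suff fin (m : nat) j : (j < m)%R -> fin_spanned (L j) (L j).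
  by move=> j; apply/finite_dimP/(fin `|j|%N.+1); lia.
elim: m j => [|m IHm] j lt_jm.
  by apply: fin_spanned_zero => u; apply: (L_neg gL).
(* The index [n], counted from 0, stands for operators of degree -(n + 1). *)
pose P (n : nat) w := exists y u, [/\ Dpm_deg e (- n.+1%:Z) y, L (j - n.+1%:Z) u & w = act y u].
apply: (@fin_spanned_sub _ _ _ (fun w => (j = 0 /\ w = v) \/
    exists2 n, (n < `|j|)%N & (j > 0)%R /\ P n w)).
  move=> u /L_generators; apply: lin_span_trans => x [xv|[i ij [y [w [yP Lw ->]]]]].
    by apply: lin_span_base; left.
  apply: lin_span_base; right; exists (`|i|.-1); first by lia.
  split; first by lia.
  exists y, w; split=> //; first by rewrite (_ : _%:Z = i) //; lia.
  by rewrite (_ : _%:Z = i) //; lia.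
apply: fin_spannedU.
  have [j0|j0] := eqVneq j 0; last by apply: fin_spanned_zero => u [/eqP]; rewrite (negPf j0).
  exists [:: v] => [x|u [_ ->]]; first by rewrite mem_seq1 => /eqP ->; rewrite j0; apply: hw_L0.
  by apply: lin_span_base; rewrite mem_head.
apply: fin_spanned_bigU => n lt_nj.
have [j0|j0] := lerP j 0; first by apply: fin_spanned_zero => u []; lia.
have [|s sL sP] := IHm (j - n.+1%:Z); first by lia.
have [q q0 qP] := kills_below `|j - n.+1%:Z|.+1 (isT : (0 < n.+1%:Z)%R) q10 q1P q1v.
have {}qP := qP (j - n.+1%:Z) ltac:(lia).
set k := - n.+1%:Z in qP *.
(* A remainder modulo [Q] need not be admissible and is projected back by [adm_proj]. Including the
   reflection of [q] in [Q] keeps the projection of a multiple of [Q] divisible by [q]. *)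
pose Q := q * (q \Po refl e k); have Q0 : Q != 0 by rewrite mulf_neq0 ?refl_eq0.
pose F a : {poly K} := adm_proj e k 'X^a.
have FP a : adm e k (F a) by apply: adm_adm_proj.
exists [seq act (tDhat k (F a)) u | a <- iota 0 (size Q), u <- s] => [x|w [_]].
  move=> /allpairsP[[a u] /= [_ us ->]].
  by have := L_act gL (Dpm_deg_tDhat (FP a)) (sL _ us); rewrite /k opprK subrK.
move=> [y [u [/Dpm_degP[f [c [fP c0 ->]]] Lu ->]]]; rewrite c0 //.
rewrite -[(tD k f, 0)]/(tDhat k f) -(adm_proj_id fP) (divp_eq f Q).
rewrite -[_ * Q]scale1r adm_projP act_tDhatP; try exact: adm_adm_proj.
rewrite qP //; last 2 first.
- exact: adm_adm_proj.
- by apply: dvdp_adm_proj; rewrite dvdp_mull.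
rewrite scaler0 add0r.
have -> : adm_proj e k (f %% Q) = \sum_(a < size Q) (f %% Q)`_a *: F a.
  have le_Q : (size ((f %% Q)%R) <= size Q)%N by apply: ltnW; rewrite ltn_modp.
  rewrite -{1}[f %% Q]coefK poly_def (big_ord_widen _ (fun a => _`_a *: 'X^a) le_Q).
  rewrite big_mkcond; elim/big_rec2: _ => [|a p r _ <-].
    by rewrite /adm_proj comp_poly0 scaler0 addr0 scaler0.
  rewrite -adm_projP; congr (adm_proj e k (_ + _)).
  by case: ltnP => // le_a; rewrite nth_default ?scale0r.
rewrite act_tDhat_sum //; apply: lin_span_sum => a.
have tD_P := Dpm_deg_Dpm (Dpm_deg_tDhat (FP a)).
elim: (sP u Lu) => [|b x w' xs _ IH]; first by rewrite (act0r gL) //; apply: lin_span_zero.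
rewrite (act_linr gL) //; apply: lin_span_add => //.
by apply: allpairs_f => //; rewrite mem_iota add0n /=.
Qed.

(** * The two implications between quasifiniteness and the recurrence *)

Lemma adm_N1_oddpart h : evenp h -> adm e (-1) (pshift (beta e) (oddpart e * h)).
Proof.
by move=> eh; apply/adm_oddpart; [right | exists h; rewrite ?Dpm_shift_N1].
Qed.

Lemma adm_1_oddpart h : evenp h -> adm e 1 (pshift (beta e + 1) (oddpart e * h)).
Proof.
by move=> eh; apply/adm_oddpart; [left | exists h; rewrite ?Dpm_shift_1].
Qed.

(** As [v] is killed in positive degree, the composite acts on it as the commutator, a degree 0
    element to which [xi] applies. *)
Lemma act_bracket_oddpart g h : evenp g -> evenp h ->
  act (tDhat 1 (pshift (beta e + 1) (oddpart e * h)))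
      (act (tDhat (-1) (pshift (beta e) (oddpart e * g))) v)
  = xi (theta e (oddpart e * oddpart e * g * h)) *: v.
Proof.
move=> eg eh.
have gD := Dpm_deg_tDhat (adm_N1_oddpart eg); have hD := Dpm_deg_tDhat (adm_1_oddpart eh).
have := act_bracket gL v (Dpm_deg_Dpm hD) (Dpm_deg_Dpm gD).
rewrite (hw_pos _ hD) // (act0r gL); last exact: Dpm_deg_Dpm gD.
rewrite subr0 => <-; rewrite bracket_theta.
have -> : oddpart e * h * (oddpart e * g) = oddpart e * oddpart e * g * h by ring.
by rewrite hw_act0 //; apply/theta_deg/(evenpM _ eh)/(evenpM _ eg)/oddpart_sqr.
Qed.

Lemma quasifinite_of_annih g :
  g != 0 -> evenp g -> annih g (moment e xi) -> quasifinite L.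
Proof.
move=> g0 eg ga; have gP := adm_N1_oddpart eg.
apply: (quasifinite_of_vanishing (q1 := pshift (beta e) (oddpart e * g))) => //.
  by rewrite pshift_eq0 mulf_neq0 ?oddpart_neq0.
apply: singular_eq0.
  by have := L_act gL (Dpm_deg_tDhat gP) hw_L0; rewrite opprK.
move=> x /Dpm_degP[f [c [/(adm_oddpart e _ (or_introl erefl))[h eh ->] c0 ->]]].
rewrite Dpm_shift_1 c0 // act_bracket_oddpart // mulrAC mulrC.
have /annih_moment-> := ga; rewrite ?scale0r //.
by apply: evenpM => //; apply: oddpart_sqr.
Qed.

(** Dimension count in L_1: n + 1 vectors t^-1 g(D + beta) v in a space spanned by n vectors are
    dependent, and a dependency is an operator of degree -1 killing [v]. *)
Lemma annih_of_quasifinite : quasifinite L ->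
  exists2 g, g != 0 & evenp g /\ annih g (moment e xi).
Proof.
move=> /(_ 1)[n [b [_ bP]]].
have eX (i : 'I_n.+1) : evenp ('X^(i.*2) : {poly K}).
  by apply: evenp_Xn; rewrite odd_double.
pose w (i : 'I_n.+1) := act (tDhat (-1) (pshift (beta e) (oddpart e * 'X^(i.*2)))) v.
have Lw m : L 1 (w m).
  by have := L_act gL (Dpm_deg_tDhat (adm_N1_oddpart (eX m))) hw_L0; rewrite opprK.
have [C CP] := fin_all_exists (fun m => bP _ (Lw m)).
pose M := \matrix_(i, j) C i j.
(* The matrix has n + 1 rows and n columns, so some non-zero row vector is sent to 0. *)
have kM : kermx M != 0.
  rewrite -mxrank_eq0 mxrank_ker subn_eq0 -ltnNge ltnS.
  exact: leq_trans (rank_leq_col M) _.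
have [r /sub_kermxP rM r0] := rowV0Pn kM.
pose p := \sum_(i < n.+1) r 0 i *: 'X^i.
pose g : {poly K} := p \Po 'X^2.
have gE : g = \sum_(i < n.+1) r 0 i *: 'X^(i.*2).
  rewrite /g /p raddf_sum; apply: eq_bigr => i _ /=.
  by rewrite comp_polyZ comp_Xn_poly -exprM mul2n.
have g0 : g != 0.
  apply: contra_neq r0 => g0; apply/rowP => i; rewrite mxE.
  have := congr1 (fun p : {poly K} => p`_(i.*2)) g0; rewrite gE coef0 coef_sum.
  rewrite (bigD1 i) //= coefZ coefXn eqxx mulr1 big1 ?addr0 // => j ji.
  by rewrite coefZ coefXn (inj_eq double_inj) eq_sym (inj_eq val_inj) (negPf ji) mulr0.
have eg : evenp g by apply: evenp_sqr.
have gv : act (tDhat (-1) (pshift (beta e) (oddpart e * g))) v = 0.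
  have -> : pshift (beta e) (oddpart e * g) =
      \sum_(i < n.+1) r 0 i *: pshift (beta e) (oddpart e * 'X^(i.*2)).
    rewrite gE mulr_sumr /pshift raddf_sum; apply: eq_bigr => i _ /=.
    by rewrite -scalerAr comp_polyZ.
  rewrite act_tDhat_sum => [|i]; last exact: adm_N1_oddpart.
  under eq_bigr => i _ do rewrite -/(w i) CP scaler_sumr.
  rewrite exchange_big big1 //= => j _.
  under eq_bigr => i _ do rewrite scalerA.
  rewrite -scaler_suml; have := congr1 (fun A : 'rV_n => A 0 j) rM.
  rewrite !mxE => rM0; rewrite -[RHS](scale0r (b j)) -[in RHS]rM0; congr (_ *: _).
  by apply: eq_bigr => i _; rewrite mxE.
(* Each of the two operators in the commutator contributes one factor [oddpart e]. *)
exists (oddpart e * oddpart e * g); first by rewrite !mulf_neq0 ?oddpart_neq0.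
have eog : evenp (oddpart e * oddpart e * g) by apply: evenpM => //; apply: oddpart_sqr.
split=> //; apply/annih_moment => // h eh.
have := act_bracket_oddpart eg eh; rewrite gv (act0r gL); last first.
  exact: Dpm_deg_Dpm (Dpm_deg_tDhat (adm_1_oddpart eh)).
by move/esym/eqP; rewrite scaler_eq0 (negPf hw_neq0) orbF => /eqP.
Qed.

Lemma quasifinite_iff : quasifinite L <->
  exists F : fps K, [/\ quasipolynomial F, fps_even F, F 0%N = 0 &
    fps_is_quotient (Delta e xi) F (two_sinh_half K)].
Proof.
rewrite (quotient_quasipolynomial xi_lin); split; first exact: annih_of_quasifinite.
by move=> [g g0 [eg ga]]; apply: quasifinite_of_annih ga.
Qed.

End HighestWeight.

(** * Specialization to the complex numbers *)

Local Open Scope complex_scope.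

Theorem theorem4p1 (R : realType) (e : sign) (xi : Dhat R[i] -> R[i])
  (xi_lin : linear_form_on (Dpm_deg e 0) xi)
  (V : lmodType R[i]) (act : Dhat R[i] -> V -> V) (L : int -> V -> Prop) (v : V)
  (LV : irreducible_hw_module e xi act L v) :
  quasifinite L <->
  exists F : fps R[i],
    [/\ quasipolynomial F, fps_even F, F 0%N = 0 &
        fps_is_quotient (Delta e xi) F (two_sinh_half R[i])].
Proof. exact: (@quasifinite_iff R[i] e xi xi_lin V act L v LV). Qed.
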